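(* Let $M$ be a model of DOAG (the theory of non-trivial divisible ordered Abelian groups), and let $A,B,C\subseteq M$ be parameter sets, where $M$ is $|A\cup B\cup C|^+$-saturated and strongly $|A\cup B\cup C|^+$-homogeneous. Let $A',B',C'$ be the divisible closures (in $M$) of the subgroups generated by $A$, $A\cup B$, $A\cup C$ respectively. Then $C$ is independent from $B$ over $A$ in the sense of forking if and only if every closed bounded interval $[b_1,b_2]$ of $M$ with bounds $b_1\le b_2$ in $B'$ which has a point in $C'$ already has a point in $A'$.
   Context: A formula $\phi(x,b)$ divides over $A$ if there is an $A$-indiscernible sequence $(b_i)_{i<\omega}$ with $b_0=b$ such that $\{\phi(x,b_i): i<\omega\}$ is inconsistent. A formula forks over $A$ if it implies (equivalently, equals) a finite disjunction of formulas (with parameters in $M$) each dividing over $A$. A partial type forks over $A$ if it implies a formula which forks over $A$. $C$ is independent from $B$ over $A$ in the sense of forking if $\mathrm{tp}(C/A\cup B)$ (for some/any enumeration of $C$) does not fork over $A$. Singletons count as closed bounded intervals. *)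

(* Defs.v *)
From mathcomp Require Import all_boot all_order all_algebra.
From mathcomp Require Import boolp classical_sets functions cardinality.
From mathcomp Require Import set_interval.

Set Implicit Arguments.
Unset Strict Implicit.
Unset Printing Implicit Defensive.

Import Order.TTheory GRing.Theory Num.Theory.

Local Open Scope classical_set_scope.
Local Open Scope card_scope.
Local Open Scope ring_scope.

(* porderZmodType imposes no compatibility between the order and the addition,
   and allows a partial order. *)
Definition is_DOAG (M : porderZmodType) : Prop :=
  [/\ forall x y : M, x <= y \/ y <= x,
      forall x y z : M, x <= y -> x + z <= y + z,
      forall (x : M) (n : nat), (0 < n)%N -> exists y : M, y *+ n = x
    & exists x : M, x <> 0].

(** First-order formulas in the language (0, +, -, <), with free variables in
    an arbitrary type V. A quantifier binds the variable None of option V. *)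

Inductive term (V : Type) : Type :=
| TVar of V
| TZero
| TAdd of term V & term V
| TOpp of term V.

Inductive formula (V : Type) : Type :=
| FEq of term V & term V
| FLt of term V & term V
| FNot of formula V
| FAnd of formula V & formula V
| FEx of formula (option V).

Fixpoint teval (M : porderZmodType) (V : Type) (e : V -> M) (t : term V) : M :=
  match t with
  | TVar v => e v
  | TZero => 0
  | TAdd t u => teval e t + teval e u
  | TOpp t => - teval e t
  end.

Fixpoint sat (M : porderZmodType) (V : Type) (e : V -> M) (f : formula V)
    {struct f} : Prop :=
  match f in formula _ return Prop with
  | FEq t u => teval e t = teval e u
  | FLt t u => teval e t < teval e u
  | FNot g => ~ sat e g
  | FAnd g h => sat e g /\ sat e h
  | FEx g => exists x : M, sat (fun v => if v is Some w then e w else x) g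
  end.

Definition join_env (M U V : Type) (e : U -> M) (e' : V -> M) (w : U + V) : M :=
  match w with inl u => e u | inr v => e' v end.

(* A formula phi(x, b) with parameters b, a finite tuple of M, in variables
   x = (x_i), i : X. *)
Record pformula (M X : Type) : Type := PFormula {
  pf_arity : nat;
  pf_form : formula (X + 'I_pf_arity);
  pf_par : 'I_pf_arity -> M }.
Arguments pf_par {M X} p _.
Arguments PFormula {M X pf_arity} pf_form pf_par.

Definition psat (M : porderZmodType) (X : Type) (c : X -> M)
    (q : pformula M X) : Prop :=
  sat (join_env c (pf_par q)) (pf_form q).

Definition params_in (M X : Type) (D : set M) (q : pformula M X) : Prop :=
  forall i, D (pf_par q i).

(* Consistency modulo the elementary diagram of M, i.e. realizability in an
   elementary extension of M, is finite satisfiability in M. *)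
Definition consistent (M : porderZmodType) (X : Type)
    (p : set (pformula M X)) : Prop :=
  forall (n : nat) (r : 'I_n -> pformula M X), (forall i, p (r i)) ->
    exists c : X -> M, forall i, psat c (r i).

(* Likewise, implication is modulo the elementary diagram of M. *)
Definition type_implies (M : porderZmodType) (X : Type)
    (p : set (pformula M X)) (q : pformula M X) : Prop :=
  exists (n : nat) (r : 'I_n -> pformula M X), (forall i, p (r i)) /\
    (forall c : X -> M, (forall i, psat c (r i)) -> psat c q).

Definition indiscernible (M : porderZmodType) (A : set M) (m : nat)
    (b : nat -> 'I_m -> M) : Prop :=
  forall (k : nat) (s t : 'I_k -> nat),
    {homo s : i j / (i < j)%N} -> {homo t : i j / (i < j)%N} ->
  forall (l : nat) (a : 'I_l -> M), (forall i, A (a i)) ->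
  forall f : formula (('I_k * 'I_m) + 'I_l),
    sat (join_env (fun ij => b (s ij.1) ij.2) a) f <->
    sat (join_env (fun ij => b (t ij.1) ij.2) a) f.

Definition divides (M : porderZmodType) (X : Type) (A : set M)
    (q : pformula M X) : Prop :=
  exists b : nat -> 'I_(pf_arity q) -> M,
    [/\ b 0%N = pf_par q,
        indiscernible A b
      & ~ consistent (range (fun i => PFormula (pf_form q) (b i)))].

Definition forks (M : porderZmodType) (X : Type) (A : set M)
    (q : pformula M X) : Prop :=
  exists (n : nat) (r : 'I_n -> pformula M X), (forall i, divides A (r i)) /\
    (forall c : X -> M, psat c q -> exists i, psat c (r i)).

Definition type_forks (M : porderZmodType) (X : Type) (A : set M)
    (p : set (pformula M X)) : Prop :=
  exists q : pformula M X, type_implies p q /\ forks A q.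

(* The type over D of the family c, in variables indexed by I. *)
Definition tp (M : porderZmodType) (I : Type) (c : I -> M) (D : set M) :
    set (pformula M I) :=
  [set q | params_in D q /\ psat c q].

(* C is enumerated by itself, through the injection set_val : C -> M. *)
Definition forking_independent (M : porderZmodType) (C B A : set M) : Prop :=
  ~ type_forks A (tp (@set_val M C) (A `|` B)).

(* K^+-saturation: |X| < |K|^+ if and only if |X| <= |K|. *)
Definition succ_saturated (M : porderZmodType) (K : set M) : Prop :=
  forall X : set M, X #<= K ->
  forall p : set (pformula M unit), (forall q, p q -> params_in X q) ->
    consistent p -> exists c : unit -> M, forall q, p q -> psat c q.

(* Only the values of f on X are relevant. *)
Definition elementary_on (M : porderZmodType) (X : set M) (f : M -> M) : Prop :=
  forall (m : nat) (b : 'I_m -> M), (forall i, X (b i)) ->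
  forall g : formula 'I_m, sat b g <-> sat (f \o b) g.

Definition automorphism (M : porderZmodType) (s : M -> M) : Prop :=
  [/\ bijective s, {morph s : x y / x + y} & {mono s : x y / x < y}].

(* Strong K^+-homogeneity. *)
Definition strongly_succ_homogeneous (M : porderZmodType) (K : set M) : Prop :=
  forall X : set M, X #<= K ->
  forall f : M -> M, elementary_on X f ->
    exists s : M -> M, automorphism s /\ (forall x, X x -> s x = f x).

Definition subgroup (M : porderZmodType) (H : set M) : Prop :=
  H 0 /\ (forall x y, H x -> H y -> H (x - y)).

Definition gen_subgroup (M : porderZmodType) (S : set M) : set M :=
  smallest (@subgroup M) S.

Definition divisible_closure (M : porderZmodType) (H : set M) : set M :=
  [set x | exists n : nat, (0 < n)%N /\ H (x *+ n)].

Definition dcl_gen (M : porderZmodType) (S : set M) : set M :=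
  divisible_closure (gen_subgroup S).

(* Main.v *)
Require Import Defs.
From HB Require Import structures.
From mathcomp Require Import all_boot all_order all_algebra.
From mathcomp Require Import ring_quotient generic_quotient.
From mathcomp Require Import boolp classical_sets functions cardinality.
From mathcomp Require Import set_interval filter.
From mathcomp Require Import lra.

(** Sufficiency of the cut condition: say that C is cut-independent from D over A
    when every closed interval with bounds in D that meets C meets A.  A point m
    of a cut of D can be added to D, in an extension, so that this persists:
    either immediately to the right or immediately to the left of the elements
    of C + D lying in the cut, since the obstructions on the two sides are
    incompatible.  Given a formula of the type of C over AB covered by finitely
    many dividing formulas, one can thus move, fixing AB, all the parameters of
    the latter and of finitely many members of their indiscernible sequences to
    a position that is cut-independent from C.  Then C satisfies one of the
    dividing formulas; as parameters of the same type over A now have the same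
    type over C, it satisfies the whole sequence, which was inconsistent.

    Necessity: if an interval meets dcl(AC) but not dcl(A), it is contained,
    after translation and scaling, in [u_0, u_1] for some A-indiscernible
    sequence u_n = e + s_n with s_n infinitesimal with respect to s_(n+1); the
    intervals [u_2n, u_(2n+1)] are pairwise disjoint.  The element e lies in
    dcl(A) when the distance from some a in dcl(A) to the interval has an
    archimedean class not represented in dcl(A), and in the cut of the interval
    over dcl(A) otherwise.

    A, B and C may be finite, and M need not be saturated enough then to realize
    the new points of the first part; they are taken in iterated ultrapowers,
    which are elementary extensions of M by quantifier elimination. *)

Set Implicit Arguments.
Unset Strict Implicit.
Unset Printing Implicit Defensive.

Import Order.TTheory GRing.Theory Num.Theory.

Local Open Scope classical_set_scope.
Local Open Scope card_scope.
Local Open Scope ring_scope.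

(** * Order, multiples and density in a divisible ordered abelian group *)

Section Basics.
Variables (M : porderZmodType) (HM : is_DOAG M).
Implicit Types x y z : M.

Lemma doag_total x y : x <= y \/ y <= x.
Proof. by case: HM. Qed.

Lemma doag_leD z x y : x <= y -> x + z <= y + z.
Proof. by case: HM => _ + _ _; apply. Qed.

Lemma doag_ltD z x y : x < y -> x + z < y + z.
Proof.
rewrite !lt_neqAle => /andP[ne le]; rewrite doag_leD // andbT.
by apply: contra ne => /eqP/addIr ->.
Qed.

Lemma doag_ltNge x y : ~ x < y <-> y <= x.
Proof.
split=> [nlt|le lt]; last by have := lt_le_trans lt le; rewrite ltxx.
by case: (doag_total x y) => //; rewrite le_eqVlt => /orP[/eqP-> //|].
Qed.

Lemma doag_leNgt x y : ~ x <= y <-> y < x.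
Proof.
split=> [nle|lt le]; last by have := lt_le_trans lt le; rewrite ltxx.
case: (doag_total x y) => // le; move: (le); rewrite le_eqVlt => /orP[/eqP e|//].
by case: nle; rewrite e.
Qed.

Lemma doag_ltgt x y : [\/ x < y, x = y | y < x].
Proof.
case: (doag_total x y); rewrite le_eqVlt => /orP[/eqP->|];
  by [constructor 2|constructor 1|constructor 3].
Qed.

Lemma doag_subr_gt0 x y : (0 < y - x) <-> (x < y).
Proof.
by split=> [/(doag_ltD x)|/(doag_ltD (- x))]; rewrite ?subrK ?add0r ?subrr.
Qed.

Lemma doag_subr_lt0 x y : (y - x < 0) <-> (y < x).
Proof.
by split=> [/(doag_ltD x)|/(doag_ltD (- x))]; rewrite ?subrK ?add0r ?subrr.
Qed.

Lemma doag_oppr_gt0 x : (0 < - x) <-> (x < 0).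
Proof. by rewrite -[- x]add0r doag_subr_gt0. Qed.

Lemma doag_oppr_lt0 x : (- x < 0) <-> (0 < x).
Proof. by rewrite -[- x]add0r doag_subr_lt0. Qed.

Lemma doag_addr_gt0 x y : 0 < x -> 0 < y -> 0 < x + y.
Proof. by move=> x0 /(doag_ltD x); rewrite add0r addrC; apply: lt_trans. Qed.

Lemma doag_mulrn_gt0 x n : 0 < x -> 0 < x *+ n.+1.
Proof.
move=> x0; elim: n => // n IH; rewrite mulrS; exact: doag_addr_gt0.
Qed.

Lemma doag_mulrn_ge0 x n : 0 <= x -> 0 <= x *+ n.
Proof.
move=> x0; elim: n => // n IH; rewrite mulrS; apply: le_trans IH _.
by have := doag_leD (x *+ n) x0; rewrite add0r.
Qed.

Lemma doag_mulrn_lt0 x n : x < 0 -> x *+ n.+1 < 0.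
Proof.
by move/doag_oppr_gt0 => /(@doag_mulrn_gt0 _ n); rewrite mulNrn doag_oppr_gt0.
Qed.

Lemma doag_pmulrn_rgt0 n x : (0 < n)%N -> (0 < x *+ n) <-> (0 < x).
Proof.
case: n => // n _; split; last exact: doag_mulrn_gt0.
case: (doag_ltgt 0 x) => [//|<-|/(@doag_mulrn_lt0 _ n) h1 h2]; first by rewrite mul0rn.
by have := lt_trans h1 h2; rewrite ltxx.
Qed.

Lemma doag_pmulrn_rlt0 n x : (0 < n)%N -> (x *+ n < 0) <-> (x < 0).
Proof.
move=> n0; have := @doag_pmulrn_rgt0 n (- x) n0.
by rewrite mulNrn !doag_oppr_gt0.
Qed.

Lemma doag_ltrMn n x y : (0 < n)%N -> (x *+ n < y *+ n) <-> (x < y).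
Proof.
by move=> n0; have := @doag_pmulrn_rgt0 n (y - x) n0; rewrite mulrnBl !doag_subr_gt0.
Qed.

Lemma doag_lerMn n x y : (0 < n)%N -> (x *+ n <= y *+ n) <-> (x <= y).
Proof. move=> n0; rewrite -(doag_ltNge (y *+ n)) -(doag_ltNge y).
by rewrite (doag_ltrMn y x n0). Qed.

Lemma doag_mulIrn n x y : (0 < n)%N -> x *+ n = y *+ n -> x = y.
Proof.
move=> n0 e; apply/le_anti/andP.
by split; apply/(doag_lerMn _ _ n0); rewrite e.
Qed.

Lemma doag_div n x : (0 < n)%N -> exists y, y *+ n = x.
Proof. by case: HM => _ _ + _; apply. Qed.

Lemma doag_gt0 : exists x : M, 0 < x.
Proof.
case: HM => _ _ _ [x xN0]; case: (doag_ltgt 0 x) => [|/esym//|x0].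
  by exists x.
by exists (- x); apply/doag_oppr_gt0.
Qed.

Lemma doag_dense x y : x < y -> exists z, x < z /\ z < y.
Proof.
move=> xy; have [z ze] := @doag_div 2 (x + y) isT; exists z.
split; apply/(@doag_ltrMn 2) => //; rewrite ze mulr2n.
  by rewrite [x + y]addrC; exact: doag_ltD.
exact: doag_ltD.
Qed.

Lemma doag_max (s : seq M) : s != [::] -> exists2 m, m \in s & forall x, x \in s -> x <= m.
Proof.
elim: s => // a s IH _; case: (eqVneq s [::]) => [->|/IH[m ms mle]].
  by exists a; rewrite ?mem_head // => x; rewrite inE => /eqP->.
case: (doag_total a m) => am.
  by exists m; rewrite ?inE ?ms ?orbT // => x; rewrite inE => /orP[/eqP->|/mle].
exists a; rewrite ?mem_head // => x; rewrite inE => /orP[/eqP->//|/mle xm].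
exact: le_trans am.
Qed.

Lemma doag_min (s : seq M) : s != [::] -> exists2 m, m \in s & forall x, x \in s -> m <= x.
Proof.
elim: s => // a s IH _; case: (eqVneq s [::]) => [->|/IH[m ms mle]].
  by exists a; rewrite ?mem_head // => x; rewrite inE => /eqP->.
case: (doag_total m a) => am.
  by exists m; rewrite ?inE ?ms ?orbT // => x; rewrite inE => /orP[/eqP->|/mle].
exists a; rewrite ?mem_head // => x; rewrite inE => /orP[/eqP->//|/mle xm].
exact: le_trans xm.
Qed.

(** Density handles two nonempty lists, the absence of endpoints the rest. Every realization of a
    cut rests on this finite case. *)
Lemma doag_between (s1 s2 : seq M) :
    (forall x y, x \in s1 -> y \in s2 -> x < y) ->
  exists z, (forall x, x \in s1 -> x < z) /\ (forall y, y \in s2 -> z < y).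
Proof.
have [e e0] := doag_gt0; move=> s12.
have [-> |/doag_max[m ms mle]] := eqVneq s1 [::];
  have [E|/doag_min[m' ms' mge]] := eqVneq s2 [::].
- by exists 0; split=> // ?; rewrite E.
- exists (m' - e); split=> // y /mge; apply: lt_le_trans.
  by have /(doag_ltD (m' - e)) := e0; rewrite add0r [e + _]addrC subrK.
- exists (m + e); split=> [x /mle xm|?]; last by rewrite E.
  by apply: (le_lt_trans xm); have /(doag_ltD m) := e0; rewrite add0r [e + _]addrC.
- have [z [mz zm']] := doag_dense (s12 _ _ ms ms'); exists z; split=> [x /mle xm|y /mge].
    exact: le_lt_trans mz.
  exact: lt_le_trans.
Qed.

End Basics.

(** * Signs of elements, and the syntax of terms *)

Definition same_sign (M N : porderZmodType) (x : M) (y : N) : Prop :=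
  (0 < x <-> 0 < y) /\ (x < 0 <-> y < 0).

Lemma same_sign_sym (M N : porderZmodType) (x : M) (y : N) :
  same_sign x y -> same_sign y x.
Proof. by case=> h1 h2; split; apply: iff_sym. Qed.

Lemma same_sign_eq0 (M N : porderZmodType) (x : M) (y : N) :
  is_DOAG M -> is_DOAG N -> same_sign x y -> (x = 0 <-> y = 0).
Proof.
move=> HM HN [hp hn]; split=> e.
  by case: (doag_ltgt HN 0 y) => [/hp||/hn] //; rewrite e ltxx.
by case: (doag_ltgt HM 0 x) => [/hp||/hn] //; rewrite e ltxx.
Qed.

Lemma same_signN (M N : porderZmodType) (x : M) (y : N) :
  is_DOAG M -> is_DOAG N -> same_sign x y -> same_sign (- x) (- y).
Proof.
move=> HM HN [hp hn].
by split; rewrite ?(doag_oppr_gt0 HM) ?(doag_oppr_gt0 HN)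
   ?(doag_oppr_lt0 HM) ?(doag_oppr_lt0 HN).
Qed.

Lemma same_sign_mulrn (M N : porderZmodType) (x : M) (y : N) n : (0 < n)%N ->
  is_DOAG M -> is_DOAG N -> (same_sign (x *+ n) (y *+ n) <-> same_sign x y).
Proof.
move=> n0 HM HN; rewrite /same_sign.
by rewrite (doag_pmulrn_rgt0 HM) // (doag_pmulrn_rgt0 HN) //
   (doag_pmulrn_rlt0 HM) // (doag_pmulrn_rlt0 HN).
Qed.

(* The environment in which [sat] evaluates the body of a quantifier. *)
Definition oenv (M V : Type) (e : V -> M) (x : M) (v : option V) : M :=
  match v with Some w => e w | None => x end.

Lemma teval_ext (M : porderZmodType) V (e e' : V -> M) t :
  e =1 e' -> teval e t = teval e' t.
Proof. by move=> h; elim: t => //= [t -> u ->|t ->]. Qed.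

Lemma sat_ext (M : porderZmodType) V (e e' : V -> M) f :
  e =1 e' -> sat e f <-> sat e' f.
Proof. by move/funext->. Qed.

Fixpoint tmuln V (t : term V) (n : nat) : term V :=
  if n is n'.+1 then TAdd t (tmuln t n') else TZero V.

Definition tmulz V (t : term V) (k : int) : term V :=
  match k with Posz n => tmuln t n | Negz n => TOpp (tmuln t n.+1) end.

Lemma teval_muln (M : porderZmodType) V (e : V -> M) t n :
  teval e (tmuln t n) = teval e t *+ n.
Proof. by elim: n => [|n /= ->]; rewrite ?mulr0n ?mulrS. Qed.

Lemma teval_mulz (M : porderZmodType) V (e : V -> M) t k :
  teval e (tmulz t k) = teval e t *~ k.
Proof. by case: k => n; rewrite /= ?teval_muln // -mulrS. Qed.

Fixpoint trename V W (h : V -> W) (t : term V) : term W :=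
  match t with
  | TVar v => TVar (h v)
  | TZero => TZero W
  | TAdd t u => TAdd (trename h t) (trename h u)
  | TOpp t => TOpp (trename h t)
  end.

Lemma teval_rename (M : porderZmodType) V W (h : V -> W) (e : W -> M) t :
  teval e (trename h t) = teval (e \o h) t.
Proof. by elim: t => //= [t -> u ->|t ->]. Qed.

Fixpoint frename V W (h : V -> W) (f : formula V) : formula W :=
  match f with
  | FEq t u => FEq (trename h t) (trename h u)
  | FLt t u => FLt (trename h t) (trename h u)
  | FNot f => FNot (frename h f)
  | FAnd f g => FAnd (frename h f) (frename h g)
  | FEx f => FEx (frename (omap h) f)
  end.

Lemma sat_rename (M : porderZmodType) V W (h : V -> W) (e : W -> M) f :
  sat e (frename h f) <-> sat (e \o h) f.
Proof.
elim: f W h e => {V} [V t u|V t u|V f IH|V f IHf g IHg|V f IH] W h e /=.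
- by rewrite !teval_rename.
- by rewrite !teval_rename.
- by rewrite IH.
- by rewrite IHf IHg.
- split=> -[x sx]; exists x.
    by move/IH: sx; congr sat; apply/funext => -[].
  by apply/IH; move: sx; congr sat; apply/funext => -[].
Qed.

(** A term is an integer linear combination, so the coefficient of the bound variable can be
    isolated. [k] and [s] come before the model because the same splitting must serve in two
    models. *)
Lemma tsplit V (t : term (option V)) : exists (k : int) (s : term V),
  forall (M : porderZmodType) (e : V -> M) x,
    teval (oenv e x) t = x *~ k + teval e s.
Proof.
elim: t => [[v|]||t [k [s h]] u [k' [s' h']]|t [k [s h]]].
- by exists 0, (TVar v) => M e x; rewrite /= mulr0z add0r.
- by exists 1, (TZero V) => M e x; rewrite /= mulr1z addr0.
- by exists 0, (TZero V) => M e x; rewrite /= mulr0z add0r.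
- by exists (k + k'), (TAdd s s') => M e x; rewrite /= h h' mulrzDr addrACA.
- by exists (- k), (TOpp s) => M e x; rewrite /= h mulrNz opprD.
Qed.

(** * Quantifier elimination *)

Lemma same_sign_mulrz (M N : porderZmodType) (x : M) (y : N) (k : int) : k != 0 ->
  is_DOAG M -> is_DOAG N -> (same_sign (x *~ k) (y *~ k) <-> same_sign x y).
Proof.
move=> k0 HM HN; case: k k0 => [[//|n]|n] _; first exact: same_sign_mulrn.
rewrite -(@same_sign_mulrn _ _ x y n.+1) //=; split=> [/(same_signN HM HN)|].
  by rewrite !opprK.
exact: same_signN.
Qed.

Lemma doag_divz (M : porderZmodType) (k : int) (x : M) :
  is_DOAG M -> k != 0 -> exists y, y *~ k = x.
Proof.
move=> HM; case: k => [[//|n]|n] _; first exact: doag_div.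
have [y yx] := doag_div HM (- x) (ltn0Sn n); exists y.
by rewrite /intmul yx opprK.
Qed.

(** If [x] is a first component, its partner serves. Otherwise the partners of the points below [x]
    lie below those of the points above, and [x'] is taken in between. *)
Lemma order_transfer (M N : porderZmodType) (HM : is_DOAG M) (HN : is_DOAG N)
    (rs : seq (M * N)) x :
    (forall p q, p \in rs -> q \in rs -> same_sign (p.1 - q.1) (p.2 - q.2)) ->
  exists x', forall p, p \in rs -> same_sign (x - p.1) (x' - p.2).
Proof.
move=> rsP; have [/hasP[p prs /eqP px]|/hasPn xN] := boolP (has (fun p => p.1 == x) rs).
  by exists p.2 => q qrs; rewrite -px; exact: rsP.
pose s1 := [seq p.2 | p <- rs & p.1 < x]; pose s2 := [seq p.2 | p <- rs & x < p.1].
have [|x' [x'1 x'2]] := @doag_between _ HN s1 s2.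
  move=> y z /mapP[p + ->] /mapP[q + ->]; rewrite !mem_filter => /andP[px prs] /andP[xq qrs].
  by apply/(doag_subr_lt0 HN)/(rsP _ _ prs qrs).2/(doag_subr_lt0 HM); exact: lt_trans xq.
exists x' => p prs; rewrite /same_sign !(doag_subr_gt0, doag_subr_lt0) //.
case: (doag_ltgt HM p.1 x) => [px|/eqP|xp].
- have lt' : p.2 < x' by apply: x'1; apply: map_f; rewrite mem_filter px.
  by split; split=> // h; [have := lt_trans px h|have := lt_trans lt' h]; rewrite ltxx.
- by move/xN: prs => /negbTE ->.
- have lt' : x' < p.2 by apply: x'2; apply: map_f; rewrite mem_filter xp.
  by split; split=> // h; [have := lt_trans xp h|have := lt_trans lt' h]; rewrite ltxx.
Qed.

(** A pair [(k, t)] stands for the linear form k x + t. The pairwise terms are, cleared of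
    denominators and up to sign, the differences of the roots -t/k; the terms t alone serve the
    forms with k = 0. *)
Definition resultants V (ls : seq (int * term V)) : seq (term V) :=
  map snd ls ++
  flatten [seq [seq TAdd (tmulz p.2 q.1) (TOpp (tmulz q.2 p.1)) | p <- ls] | q <- ls].

Lemma In_map (T U : Type) (f : T -> U) x s : List.In x s -> List.In (f x) (map f s).
Proof. by elim: s => //= a s IH [->|/IH]; [left|right]. Qed.

Lemma In_flatten (T : Type) (x : T) s ss : List.In x s -> List.In s ss -> List.In x (flatten ss).
Proof.
move=> xs; elim: ss => //= a ss IH [->|/IH h]; apply/List.in_or_app; [left|right] => //.
Qed.

(** The roots exist in both models by divisibility. The resultants say that they are ordered alike,
    and [order_transfer] places [x'] among them as [x] is. *)
Lemma resultants_lift (M N : porderZmodType) (HM : is_DOAG M) (HN : is_DOAG N)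
    V (ls : seq (int * term V)) (e : V -> M) (e' : V -> N) x :
    (forall t, List.In t (resultants ls) -> same_sign (teval e t) (teval e' t)) ->
  exists x', forall p, List.In p ls ->
    same_sign (x *~ p.1 + teval e p.2) (x' *~ p.1 + teval e' p.2).
Proof.
move=> agr.
have agr0 p : List.In p ls -> same_sign (teval e p.2) (teval e' p.2).
  by move=> pl; apply/agr/List.in_or_app; left; exact: In_map.
have agr2 p q : List.In p ls -> List.In q ls ->
  same_sign (teval e p.2 *~ q.1 - teval e q.2 *~ p.1)
            (teval e' p.2 *~ q.1 - teval e' q.2 *~ p.1).
  move=> pl ql.
  suff /agr : List.In (TAdd (tmulz p.2 q.1) (TOpp (tmulz q.2 p.1))) (resultants ls).
    by rewrite /= !teval_mulz.
  apply/List.in_or_app; right; apply: In_flatten; last by exact: In_map ql.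
  exact: In_map (fun p => TAdd (tmulz p.2 q.1) (TOpp (tmulz q.2 p.1))) _ _ pl.
pose root r (p : int * term V) := p.1 != 0 /\
  (r.1 *~ p.1 = - teval e p.2 /\ r.2 *~ p.1 = - teval e' p.2).
have [rs [rs1 rs2]] : exists rs : seq (M * N),
    (forall r, r \in rs -> exists2 p, List.In p ls & root r p) /\
    (forall p, List.In p ls -> p.1 != 0 -> exists2 r, r \in rs & root r p).
  elim: (ls) => [|p ls' [rs [rs1 rs2]]]; first by exists [::].
  have [p0|p0] := eqVneq p.1 0.
    exists rs; split=> [r /rs1[q ql rq]|q /= [<-|]]; first by exists q => //; right.
      by rewrite p0.
    exact: rs2.
  have [r re] := doag_divz (- teval e p.2) HM p0.
  have [r' re'] := doag_divz (- teval e' p.2) HN p0.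
  exists ((r, r') :: rs); split=> [q|q /=].
    rewrite inE => /orP[/eqP->|/rs1[q' ql rq]]; last by exists q' => //; right.
    by exists p; [left|].
  case=> [<- _|/rs2 h /h[r0 r0s rr]]; first by exists (r, r'); rewrite ?mem_head.
  by exists r0; rewrite // inE r0s orbT.
have [|x' x'P] := @order_transfer _ _ HM HN rs x.
  move=> r q /rs1[p pl [p0 [re re']]] /rs1[p' p'l [p'0 [qe qe']]].
  apply/(@same_sign_mulrz _ _ _ _ (p.1 * p'.1)) => //; first by rewrite mulf_neq0.
  have eqs (P : porderZmodType) (a b : P) : (a - b) *~ (p.1 * p'.1) =
     (a *~ p.1) *~ p'.1 - (b *~ p'.1) *~ p.1.
    by rewrite mulrzBl -!mulrzA [p'.1 * p.1]mulrC.
  rewrite !eqs re re' qe qe' !mulNrz -!opprD.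
  by apply: same_signN => //; exact: agr2.
exists x' => p pl; have [p0|p0] := eqVneq p.1 0.
  by rewrite p0 !mulr0z !add0r; exact: agr0.
have [r rrs [_ [re re']]] := rs2 p pl p0.
move/eqP: re; rewrite -eqr_oppLR => /eqP <-; move/eqP: re'; rewrite -eqr_oppLR => /eqP <-.
by rewrite -!mulrzBl; apply/same_sign_mulrz => //; exact: x'P.
Qed.

(* Fourier-Motzkin elimination, in the semantic form needed here: the truth
   value of a formula only depends on the signs of finitely many terms, the
   same ones in all models. *)
Lemma sat_determined V (f : formula V) : exists l : seq (term V),
  forall M N : porderZmodType, is_DOAG M -> is_DOAG N ->
  forall (e : V -> M) (e' : V -> N),
    (forall t, List.In t l -> same_sign (teval e t) (teval e' t)) ->
  sat e f <-> sat e' f.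
Proof.
elim: f => {V} [V t u|V t u|V f [l IH]|V f [l IHf] g [l' IHg]|V f [l IH]].
- exists [:: TAdd t (TOpp u)] => M N HM HN e e' /(_ _ (or_introl erefl)) /= h.
  have E := same_sign_eq0 HM HN h.
  by split=> /eqP; rewrite -subr_eq0 => /eqP/E/eqP; rewrite subr_eq0 => /eqP.
- exists [:: TAdd t (TOpp u)] => M N HM HN e e' /(_ _ (or_introl erefl)) /= [_].
  by rewrite !doag_subr_lt0.
- by exists l => M N HM HN e e' h /=; rewrite (IH M N HM HN e e' h).
- exists (l ++ l') => M N HM HN e e' h /=.
  rewrite (IHf M N HM HN e e') ?(IHg M N HM HN e e') // => t tl;
    by apply/h/List.in_or_app; first [by left|by right].
have [ls lsP] : exists ls : seq (int * term V), forall t, List.In t l ->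
    exists2 p, List.In p ls & forall (M : porderZmodType) (e : V -> M) x,
      teval (oenv e x) t = x *~ p.1 + teval e p.2.
  elim: (l) => [|t l' [ls lsP]]; first by exists [::].
  have [k [s ks]] := tsplit t; exists ((k, s) :: ls) => u /= [<-|/lsP[p pl h]].
    by exists (k, s) => //; left.
  by exists p => //; right.
exists (resultants ls) => M N HM HN e e' h.
have half (P Q : porderZmodType) (HP : is_DOAG P) (HQ : is_DOAG Q)
    (ep : V -> P) (eq : V -> Q) :
    (forall t, List.In t (resultants ls) -> same_sign (teval ep t) (teval eq t)) ->
    sat ep (FEx f) -> sat eq (FEx f).
  move=> agr [x sx]; have [x' x'P] := resultants_lift HP HQ x agr; exists x'.
  rewrite -/(oenv eq x') -(IH P Q HP HQ (oenv ep x)) // => t /lsP[p pl te].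
  by rewrite !te; exact: x'P.
split; first exact: half.
by apply: half => // t /h /same_sign_sym.
Qed.

Definition agree (M N : porderZmodType) V (e : V -> M) (e' : V -> N) : Prop :=
  forall t, same_sign (teval e t) (teval e' t).

Lemma agree_sat (M N : porderZmodType) V (e : V -> M) (e' : V -> N) f :
  is_DOAG M -> is_DOAG N -> agree e e' -> (sat e f <-> sat e' f).
Proof.
by move=> HM HN agr; have [l lP] := sat_determined f; apply: lP => // t _; exact: agr.
Qed.

Lemma sat_finite_support V (f : formula V) : exists vs : seq V,
  forall (M : porderZmodType) (e e' : V -> M),
    (forall v, List.In v vs -> e v = e' v) -> sat e f -> sat e' f.
Proof.
have tsupp W (t : term W) : exists vs : seq W, forall (M : porderZmodType) (e e' : W -> M),
    (forall v, List.In v vs -> e v = e' v) -> teval e t = teval e' t.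
  elim: t => [v||t [l h] u [l' h']|t [l h]].
  - by exists [:: v] => M e e'; apply; left.
  - by exists [::].
  - exists (l ++ l') => M e e' E /=; rewrite (h M e e') ?(h' M e e') // => v vl;
    by apply/E/List.in_or_app; first [by left|by right].
  - by exists l => M e e' E /=; rewrite (h M e e').
suff: exists vs : seq V, forall (M : porderZmodType) (e e' : V -> M),
    (forall v, List.In v vs -> e v = e' v) -> sat e f <-> sat e' f.
  by case=> vs h; exists vs => M e e' /h [].
elim: f => {V} [V t u|V t u|V f [l IH]|V f [l IHf] g [l' IHg]|V f [l IH]].
- have [l h] := tsupp V t; have [l' h'] := tsupp V u; exists (l ++ l') => M e e' E /=.
  by rewrite (h M e e') ?(h' M e e') // => v vl; apply/E/List.in_or_app; [right|left].
- have [l h] := tsupp V t; have [l' h'] := tsupp V u; exists (l ++ l') => M e e' E /=.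
  by rewrite (h M e e') ?(h' M e e') // => v vl; apply/E/List.in_or_app; [right|left].
- by exists l => M e e' E /=; rewrite (IH M e e').
- exists (l ++ l') => M e e' E /=.
  by rewrite (IHf M e e') ?(IHg M e e') // => v vl; apply/E/List.in_or_app; [right|left].
have [vs vsP] : exists vs : seq V, forall v, List.In (Some v) l -> List.In v vs.
  elim: (l) => [|[v|] l' [vs vsP]]; first by exists [::].
    by exists (v :: vs) => w /= [[->]|/vsP]; [left|right].
  by exists vs => w /= [|/vsP].
exists vs => M e e' E /=.
have h x : sat (oenv e x) f <-> sat (oenv e' x) f.
  by apply: IH => -[v|] //= /vsP /E.
by split=> -[x sx]; exists x; [exact: (h x).1 sx|exact: (h x).2 sx].
Qed.

(** With the variables from [X] set to 0, a term becomes a term in [W]. This settles the case where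
    no variable from [X] matters any more. *)
Lemma agree_join0 (M N : porderZmodType) X W (e : W -> M) (e' : W -> N) :
  agree e e' -> agree (join_env (fun _ : X => 0) e) (join_env (fun _ : X => 0) e').
Proof.
move=> agr t.
have [s sP] : exists s : term W, forall (P : porderZmodType) (e : W -> P),
    teval (join_env (fun _ : X => 0) e) t = teval e s.
  elim: t => [[x|w]||t [s h] u [s' h']|t [s h]].
  - by exists (TZero W).
  - by exists (TVar w).
  - by exists (TZero W).
  - by exists (TAdd s s') => P a /=; rewrite h h'.
  - by exists (TOpp s) => P a /=; rewrite h.
by rewrite !sP.
Qed.

(* The quantification over the possibly infinite family [x] only concerns the
   finitely many variables of [f], which are closed off one at a time. *)
Lemma sat_ex_transfer (M N : porderZmodType) X W (f : formula (X + W))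
    (e : W -> M) (e' : W -> N) (y : X -> N) :
  is_DOAG M -> is_DOAG N -> agree e e' -> sat (join_env y e') f ->
  exists x : X -> M, sat (join_env x e) f.
Proof.
move=> HM HN agr sy; have [vs vsP] := sat_finite_support f.
have [xs xsP] : exists xs : seq X, forall x, List.In (inl x) vs -> List.In x xs.
  elim: (vs) => [|[v|w] l' [xs xsP]]; first by exists [::].
    by exists (v :: xs) => w /= [[->]|/xsP]; [left|right].
  by exists xs => w' /= [|/xsP].
have {xsP vsP vs} : forall (P : porderZmodType) (a b : X -> P) (w : W -> P),
    (forall x, List.In x xs -> a x = b x) -> sat (join_env a w) f -> sat (join_env b w) f.
  by move=> P a b w ab; apply: vsP => -[x /xsP /ab|].
elim: xs f sy => [|x0 xs IH] f sy supp.
  exists (fun=> 0); apply/(agree_sat f HM HN (agree_join0 agr)).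
  by apply: supp sy.
pose h (v : X + W) : option (X + W) := match v with
  | inl x => if pselect (x = x0) then None else Some (inl x)
  | inr w => Some (inr w) end.
pose upd (P : Type) (a : X -> P) z x := if pselect (x = x0) then z else a x.
have fE (P : porderZmodType) (a : X -> P) (w : W -> P) z :
    sat (oenv (join_env a w) z) (frename h f) <-> sat (join_env (upd _ a z) w) f.
  rewrite sat_rename; apply: sat_ext => -[x|//] /=.
  by rewrite /upd; case: pselect.
have [||x [z /(fE _ x) sx]] := IH (FEx (frename h f)).
- exists (y x0); apply: (fE _ _ _ _).2; suff -> : upd _ y (y x0) = y by [].
  by apply/funext => x; rewrite /upd; case: pselect => //= ->.
- move=> P a b w ab [z /(fE _ a) sz]; exists z; apply: (fE _ b _ _).2; apply: supp sz => x /= xx.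
  by rewrite /upd; case: pselect => // xN; apply: ab; case: xx => // /esym.
- by exists (upd _ x z).
Qed.

(** * Linear arithmetic in a DOAG, by transfer from the rationals *)

Inductive lterm : Type :=
| LVar of nat | LZero | LAdd of lterm & lterm | LOpp of lterm | LMuln of lterm & nat.

Inductive latom : Type := LLe of lterm & lterm | LLt of lterm & lterm | LEq of lterm & lterm.

Fixpoint leval (M : porderZmodType) (e : nat -> M) (t : lterm) : M :=
  match t with
  | LVar i => e i
  | LZero => 0
  | LAdd t u => leval e t + leval e u
  | LOpp t => - leval e t
  | LMuln t n => leval e t *+ n
  end.

Definition aeval (M : porderZmodType) (e : nat -> M) (a : latom) : Prop :=
  match a with
  | LLe t u => leval e t <= leval e u
  | LLt t u => leval e t < leval e u
  | LEq t u => leval e t = leval e u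
  end.

Fixpoint leval_all (M : porderZmodType) (e : nat -> M) (l : seq latom) : Prop :=
  if l is a :: l then aeval e a /\ leval_all e l else True.

(** The summand [void] leaves no parameters: [sat_ex_transfer] quantifies all variables, and
    satisfiability becomes a sentence. *)
Fixpoint term_of_lterm (t : lterm) : term (nat + void) :=
  match t with
  | LVar i => TVar (inl i)
  | LZero => TZero _
  | LAdd t u => TAdd (term_of_lterm t) (term_of_lterm u)
  | LOpp t => TOpp (term_of_lterm t)
  | LMuln t n => tmuln (term_of_lterm t) n
  end.

Definition formula_of_latom (a : latom) : formula (nat + void) :=
  match a with
  | LLe t u => FNot (FLt (term_of_lterm u) (term_of_lterm t))
  | LLt t u => FLt (term_of_lterm t) (term_of_lterm u)
  | LEq t u => FEq (term_of_lterm t) (term_of_lterm u)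
  end.

Definition formula_of_latoms (l : seq latom) : formula (nat + void) :=
  foldr (fun a f => FAnd (formula_of_latom a) f) (FEq (TZero _) (TZero _)) l.

Lemma sat_formula_of_latoms (M : porderZmodType) (HM : is_DOAG M) (e : nat -> M) z l :
  sat (join_env e z) (formula_of_latoms l) <-> leval_all e l.
Proof.
have tE t : teval (join_env e z) (term_of_lterm t) = leval e t.
  by elim: t => //= [t -> u ->|t ->|t IH n] //; rewrite teval_muln IH.
elim: l => [|a l IH] //=; rewrite IH; case: a => t u /=; rewrite !tE //.
by rewrite doag_ltNge.
Qed.

Lemma rat_DOAG : is_DOAG rat.
Proof.
split=> [x y|x y z xy|x n n0|].
- by case: (lerP x y) => [|/ltW]; [left|right].
- by rewrite lerD2r.
- by exists (x / n%:R); rewrite -(mulr_natr (x / n%:R)) divfK // pnatr_eq0 -lt0n.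
- by exists 1; apply/eqP; rewrite oner_eq0.
Qed.

(** Closed terms vanish in all models, so a system solvable in [M] is solvable in [rat]. The
    contradiction over [rat] is phrased as an inequality to suit [lra]. *)
Lemma latoms_transfer (l : seq latom) :
  (forall e : nat -> rat, leval_all e l -> 0 < 0 :> rat) ->
  forall M : porderZmodType, is_DOAG M -> forall e : nat -> M, ~ leval_all e l.
Proof.
move=> ratP M HM e /(sat_formula_of_latoms HM e (of_void M)) se.
have agr : agree (of_void rat) (of_void M).
  move=> t; suff tE (P : porderZmodType) (w : void -> P) : teval w t = 0.
    by rewrite !tE /same_sign !ltxx.
  by elim: t => //= [t -> u ->|t ->]; rewrite ?addr0 ?oppr0.
have [x] := sat_ex_transfer rat_DOAG HM agr se.
by move/(sat_formula_of_latoms rat_DOAG)/ratP; rewrite ltxx.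
Qed.

Lemma doag_le_by_contra (M : porderZmodType) (x y : M) :
  is_DOAG M -> (y < x -> False) -> x <= y.
Proof. by move=> HM h; apply/(doag_ltNge HM). Qed.

Lemma doag_lt_by_contra (M : porderZmodType) (x y : M) :
  is_DOAG M -> (y <= x -> False) -> x < y.
Proof. by move=> HM h; apply/(doag_leNgt HM). Qed.

Lemma doag_eq_by_contra (M : porderZmodType) (x y : M) :
  is_DOAG M -> (x < y -> False) -> (y < x -> False) -> x = y.
Proof. by move=> HM h h'; case: (doag_ltgt HM x y). Qed.

(** Running [unify] under [match constr:(tt)] lets its success or failure select a branch while a
    term is returned. *)
Ltac in_list x l :=
  lazymatch l with
  | nil => constr:(false)
  | cons ?y ?l' => let b := match constr:(tt) with
      | _ => let _ := match constr:(tt) with _ => first [constr_eq x y | unify x y] end in constr:(true)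
      | _ => in_list x l' end in b
  end.

Ltac add_list x l :=
  let b := in_list x l in
  lazymatch b with true => l | false => constr:(cons x l) end.

Ltac index_of x l :=
  lazymatch l with
  | cons ?y ?l' => match constr:(tt) with
      | _ => let _ := match constr:(tt) with _ => first [constr_eq x y | unify x y] end in constr:(O)
      | _ => let n := index_of x l' in constr:(S n) end
  end.

Ltac is_natconst n :=
  lazymatch n with O => idtac | S ?m => is_natconst m end.

Ltac lterm_vars t l :=
  lazymatch t with
  | @GRing.add _ ?a ?b => let l1 := lterm_vars a l in lterm_vars b l1
  | @GRing.opp _ ?a => lterm_vars a l
  | @GRing.zero _ => l
  | @GRing.natmul _ ?a ?n =>
      match constr:(tt) with
      | _ => let _ := match constr:(tt) with _ => is_natconst n end in lterm_vars a l
      | _ => add_list t l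
      end
  | _ => add_list t l
  end.

Ltac lterm_of t l :=
  lazymatch t with
  | @GRing.add _ ?a ?b =>
      let a' := lterm_of a l in let b' := lterm_of b l in constr:(LAdd a' b')
  | @GRing.opp _ ?a => let a' := lterm_of a l in constr:(LOpp a')
  | @GRing.zero _ => constr:(LZero)
  | @GRing.natmul _ ?a ?n =>
      match constr:(tt) with
      | _ => let _ := match constr:(tt) with _ => is_natconst n end in
             let a' := lterm_of a l in constr:(LMuln a' n)
      | _ => let i := index_of t l in constr:(LVar i)
      end
  | _ => let i := index_of t l in constr:(LVar i)
  end.

Ltac latoms_vars M g l :=
  lazymatch g with
  | is_true (@Order.le _ _ ?a ?b) -> ?g' =>
      let l1 := lterm_vars a l in let l2 := lterm_vars b l1 in latoms_vars M g' l2
  | is_true (@Order.lt _ _ ?a ?b) -> ?g' =>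
      let l1 := lterm_vars a l in let l2 := lterm_vars b l1 in latoms_vars M g' l2
  | ?a = ?b -> ?g' =>
      let l1 := lterm_vars a l in let l2 := lterm_vars b l1 in latoms_vars M g' l2
  | False => l
  end.

Ltac latoms_of g l :=
  lazymatch g with
  | is_true (@Order.le _ _ ?a ?b) -> ?g' =>
      let a' := lterm_of a l in let b' := lterm_of b l in
      let r := latoms_of g' l in constr:(cons (LLe a' b') r)
  | is_true (@Order.lt _ _ ?a ?b) -> ?g' =>
      let a' := lterm_of a l in let b' := lterm_of b l in
      let r := latoms_of g' l in constr:(cons (LLt a' b') r)
  | ?a = ?b -> ?g' =>
      let a' := lterm_of a l in let b' := lterm_of b l in
      let r := latoms_of g' l in constr:(cons (LEq a' b') r)
  | False => constr:(@nil latom)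
  end.

Ltac conj_intros :=
  lazymatch goal with
  | |- _ -> _ => intro; conj_intros
  | H : _ /\ _ |- _ => destruct H; conj_intros
  | _ => idtac
  end.

Ltac doag_core M HM :=
  lazymatch goal with |- ?g =>
    let l := latoms_vars M g (@nil (Num.POrderedZmodule.sort M)) in
    let r := latoms_of g l in
    let H := fresh "H" in
    have H : forall e : nat -> rat, leval_all e r -> is_true ((0 : rat) < 0);
    [ let e := fresh "e" in intro e; cbn [leval_all aeval leval]; conj_intros; lra
    | move/(_ M HM (fun i => nth 0 l i)): (latoms_transfer H);
      cbn [leval_all aeval leval nth]; tauto ]
  end.

Ltac revert_atoms M :=
  repeat match goal with
  | H : is_true (@Order.le _ _ ?x _) |- _ =>
      let T := type of x in unify T (Num.POrderedZmodule.sort M); revert H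
  | H : is_true (@Order.lt _ _ ?x _) |- _ =>
      let T := type of x in unify T (Num.POrderedZmodule.sort M); revert H
  | H : @eq ?T _ _ |- _ => unify T (Num.POrderedZmodule.sort M); revert H
  end.

(** A linear goal is negated, the hypotheses are reified, and the system is refuted over [rat] by
    [lra], hence in the model. *)
Ltac dlra HM :=
  lazymatch type of HM with is_DOAG ?M =>
    intros;
    lazymatch goal with
    | |- is_true (@Order.le _ _ _ _) => apply: (doag_le_by_contra HM); intro
    | |- is_true (@Order.lt _ _ _ _) => apply: (doag_lt_by_contra HM); intro
    | |- _ = _ => apply: (doag_eq_by_contra HM); intro
    | |- False => idtac
    | |- _ => exfalso
    end;
    revert_atoms M; doag_core M HM
  end.


(** * Ultrapowers *)

Section Ultrapower.
Variables (N : porderZmodType) (U : set_system N).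
Context {UF : UltraFilter U}.

(** The index set is [N] itself, so that the class of the identity is a new point whose position is
    dictated by the ultrafilter. *)
Definition negligible (f : N -> N) : bool := `[< U [set i | f i = 0] >].

Lemma negligible_zmod_closed : zmod_closed negligible.
Proof.
split=> [|f g]; first by apply/asboolP; apply: filterS filterT.
rewrite !unfold_in => /asboolP Uf /asboolP Ug; apply/asboolP.
by apply: filterS2 Uf Ug => i fi gi; change (f i - g i = 0); rewrite fi gi subr0.
Qed.

HB.instance Definition _ :=
  GRing.isZmodClosed.Build (N -> N) negligible negligible_zmod_closed.

Definition negligible_zmodClosed := GRing.ZmodClosed.clone (N -> N) negligible _.

Definition upow : Type := Quotient.quot negligible_zmodClosed.
HB.instance Definition _ := GRing.Zmodule.on upow.

Local Open Scope quotient_scope.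

Definition upow_class (f : N -> N) : upow := \pi_(Quotient.quot negligible_zmodClosed)%qT f.
Definition upow_repr (x : upow) : N -> N := repr (x : Quotient.quot negligible_zmodClosed).

Lemma upow_reprK x : upow_class (upow_repr x) = x.
Proof. exact: reprK. Qed.

Lemma upow_class_eq f g : upow_class f = upow_class g <-> U [set i | f i = g i].
Proof.
have -> : (upow_class f = upow_class g) = (f - g \in negligible).
  by apply/propext; split=> [/eqP|h]; [|apply/eqP];
    rewrite /upow_class ?Quotient.idealrBE -?Quotient.idealrBE.
rewrite unfold_in asboolE; split; apply: filterS => i /=.
  by move/eqP; rewrite subr_eq0 => /eqP.
by move=> h; change (f i - g i = 0); rewrite h subrr.
Qed.

Lemma upow_reprE f : U [set i | upow_repr (upow_class f) i = f i].
Proof. by apply/upow_class_eq; rewrite upow_reprK. Qed.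

Lemma upow_classD f g : upow_class (f + g) = upow_class f + upow_class g.
Proof. exact: raddfD. Qed.

Definition upow_le (x y : upow) : bool := `[< U [set i | upow_repr x i <= upow_repr y i] >].

Lemma upow_le_refl : reflexive upow_le.
Proof. by move=> x; apply/asboolP; apply: filterS filterT => i _ /=. Qed.

Lemma upow_le_anti : antisymmetric upow_le.
Proof.
move=> x y /andP[/asboolP xy /asboolP yx].
rewrite -(upow_reprK x) -(upow_reprK y); apply/upow_class_eq.
by apply: filterS2 xy yx => i /= h1 h2; apply/le_anti/andP.
Qed.

Lemma upow_le_trans : transitive upow_le.
Proof.
move=> y x z /asboolP xy /asboolP yz; apply/asboolP.
by apply: filterS2 xy yz => i /=; exact: le_trans.
Qed.

HB.instance Definition _ := Order.Le_isPOrder.Build ring_display upow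
  upow_le_refl upow_le_anti upow_le_trans.

Lemma upow_leE f g : (upow_class f <= upow_class g) <-> U [set i | f i <= g i].
Proof.
split=> [/asboolP h|h]; last apply/asboolP.
  by apply: filterS3 h (upow_reprE f) (upow_reprE g) => i /= h <- <-.
by apply: filterS3 h (upow_reprE f) (upow_reprE g) => i /= h -> ->.
Qed.

Hypothesis HN : is_DOAG N.

Lemma upow_ltE f g : (upow_class f < upow_class g) <-> U [set i | f i < g i].
Proof.
rewrite lt_neqAle; split=> [/andP[/eqP ne /upow_leE le]|lt].
  have [//|ge] := in_ultra_setVsetC [set i | f i < g i] UF.
  case: ne; apply/upow_class_eq; apply: filterS2 le ge => i /= h1 /(doag_ltNge HN) h2.
  exact/le_anti/andP.
apply/andP; split; last by apply/upow_leE; apply: filterS lt => i /ltW.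
apply/eqP => /upow_class_eq eq; have /filter_ex[i [/= e]] : U ([set i | f i = g i] `&` [set i | f i < g i]) by apply: filterI.
by rewrite e ltxx.
Qed.

Lemma upow_DOAG : is_DOAG upow.
Proof.
split=> [x y|x y z|x n n0|].
- rewrite -(upow_reprK x) -(upow_reprK y).
  have [h|h] := in_ultra_setVsetC [set i | upow_repr x i <= upow_repr y i] UF.
    by left; apply/upow_leE.
  by right; apply/upow_leE; apply: filterS h => i /= /(doag_leNgt HN) /ltW.
- rewrite -(upow_reprK x) -(upow_reprK y) -(upow_reprK z) -!upow_classD => /upow_leE h.
  by apply/upow_leE; apply: filterS h => i /= h; exact: doag_leD.
- have [f fE] := choice (fun i => doag_div HN (upow_repr x i) n0).
  exists (upow_class f); rewrite -[RHS]upow_reprK -raddfMn; congr upow_class.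
  by apply/funext => i; rewrite -fE; elim: (n) => // m IH; rewrite !mulrS -IH.
- have [x x0] := doag_gt0 HN; exists (upow_class (fun=> x)); rewrite -(upow_reprK 0).
  move/upow_class_eq => h.
  have h0 : U [set i | upow_repr 0 i = 0].
    apply/upow_class_eq; rewrite upow_reprK; apply/esym.
    exact: raddf0.
  have /filter_ex[i [/= e e0]] : U ([set i | x = upow_repr 0 i] `&` [set i | upow_repr 0 i = 0]) by apply: filterI.
  by move: x0; rewrite e e0 ltxx.
Qed.

End Ultrapower.

Arguments upow {N} U {UF}.
Arguments upow_class {N} U {UF} f.

Definition embedding (M N : porderZmodType) (j : M -> N) : Prop :=
  {morph j : x y / x + y} /\ (forall x y, x < y -> j x < j y).

(** The sets of points between finitely many elements of [X] and finitely many of [Y] form a filter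
    base on [N]. In the ultrapower by an ultrafilter containing them, the class of the identity
    fills the cut. *)
Lemma cut_realization (N : porderZmodType) (X Y : set N) :
    is_DOAG N -> (forall x y, X x -> Y y -> x < y) ->
  exists (N' : porderZmodType) (j : N -> N') (m : N'),
    [/\ is_DOAG N', embedding j, forall x, X x -> j x < m & forall y, Y y -> m < j y].
Proof.
move=> HN XY.
pose D := [set s : seq N * seq N | (forall x, x \in s.1 -> X x) /\ (forall y, y \in s.2 -> Y y)].
pose B (s : seq N * seq N) := [set z | (forall x, x \in s.1 -> x < z) /\ (forall y, y \in s.2 -> z < y)].
have FF : ProperFilter (filter_from D B).
  apply: filter_from_proper => [|s [s1 s2]]; last first.
    by apply: doag_between => // x y /s1 Xx /s2 Yy; exact: XY.
  apply: filter_from_filter; first by exists ([::], [::]).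
  move=> s t [s1 s2] [t1 t2]; exists (s.1 ++ t.1, s.2 ++ t.2).
    by split=> x; rewrite mem_cat => /orP[]; [exact: s1|exact: t1|exact: s2|exact: t2].
  move=> z [z1 z2]; split; split=> x xs; by [apply: z1; rewrite mem_cat xs ?orbT|apply: z2; rewrite mem_cat xs ?orbT].
have [U [UF sU]] := ultraFilterLemma FF.
exists (upow U), (fun x => upow_class U (fun=> x)), (upow_class U id); split.
- exact: upow_DOAG.
- split=> [x y|x y xy]; first by rewrite -upow_classD.
  by apply/upow_ltE => //; apply: filterS filterT.
- move=> x Xx; apply/upow_ltE => //; apply: sU; exists ([:: x], [::]).
    by split=> // y; rewrite inE => /eqP->.
  by move=> z [z1 _]; apply: z1; rewrite mem_head.
- move=> y Yy; apply/upow_ltE => //; apply: sU; exists ([::], [:: y]).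
    by split=> // x; rewrite inE => /eqP->.
  by move=> z [_ z2]; apply: z2; rewrite mem_head.
Qed.

(** * Amalgamation over a cut *)

Definition divsub (M : porderZmodType) (S : set M) : Prop :=
  [/\ S 0, forall x y, S x -> S y -> S (x - y)
    & forall x n, (0 < n)%N -> S (x *+ n) -> S x].

Section Divsub.
Variables (M : porderZmodType) (S : set M).
Hypotheses (HM : is_DOAG M) (SP : divsub S).

Lemma divsub0 : S 0. Proof. by case: SP. Qed.
Lemma divsubB x y : S x -> S y -> S (x - y). Proof. by case: SP => _ + _; apply. Qed.
Lemma divsubN x : S x -> S (- x).
Proof. by move=> Sx; rewrite -[- x]add0r; apply: divsubB => //; exact: divsub0. Qed.
Lemma divsubD x y : S x -> S y -> S (x + y).
Proof. by move=> Sx Sy; rewrite -[y]opprK; apply/divsubB/divsubN. Qed.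
Lemma divsubMn x n : S x -> S (x *+ n).
Proof.
by move=> Sx; elim: n => [|n IH]; [exact: divsub0|rewrite mulrS; exact: divsubD].
Qed.
Lemma divsub_div x n : (0 < n)%N -> S x -> exists2 y, S y & y *+ n = x.
Proof.
move=> n0 Sx; have [y yx] := doag_div HM x n0; exists y => //.
by case: SP => _ _ /(_ y n n0); apply; rewrite yx.
Qed.

End Divsub.

Definition cut_independent (M : porderZmodType) (A C D : set M) : Prop :=
  forall d1 d2 c, D d1 -> D d2 -> C c -> d1 <= c -> c <= d2 ->
  exists2 a, A a & d1 <= a /\ a <= d2.

(* The configuration which prevents one from realizing the cut (L, U) of D to
   the right of C + D. *)
Definition right_obstruction (M : porderZmodType) (A C D L U : set M) (b l0 c : M) : Prop :=
  [/\ [/\ D b, C c & L l0],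
      forall l, L l -> l < c - b,
      forall u, U u -> c - b < u,
      forall a, A a -> L (a - b) -> a - b < l0
    & forall u, U u -> exists2 a, A a & U (a - b) /\ a - b <= u].

Section OneCut.
Variables (M : porderZmodType) (A C D L U : set M).
Hypotheses (HM : is_DOAG M) (AP : divsub A) (CP : divsub C) (DP : divsub D).
Hypotheses (AD : A `<=` D) (DLU : forall x, D x <-> L x \/ U x).
Hypothesis LltU : forall l u, L l -> U u -> l < u.
Hypothesis ind : cut_independent A C D.

Let LD l : L l -> D l. Proof. by move=> h; apply/DLU; left. Qed.
Let UD u : U u -> D u. Proof. by move=> h; apply/DLU; right. Qed.

(** By the first obstruction, A - b is coinitial in [U] but its part in [L] stays below [l0]; by the
    second, b' - A is cofinal in [L] but its part in [U] stays above -m0. As A comes as close to b +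
    b' as the width of the cut, combining elements of A yields a point of b' - A that fits neither
    in [L] nor in [U]. The case where the middle [w] of [l0] and -m0 is in [U] is the mirror
    image. *)
Lemma no_two_obstructions b l0 c b' m0 c' w :
    right_obstruction A C D L U b l0 c ->
    right_obstruction A C D [set x | U (- x)] [set x | L (- x)] b' m0 c' ->
  w *+ 2 = l0 - m0 -> L w -> False.
Proof.
move=> [[Db Cc Ll0] Lg gU R1 _] [[Db' Cc' /= Um0] Ug' g'L R1' R2'] w2 Lw.
(* c - b and b' - c' both lie in the cut, so c + c' is within u - l of b + b'; cut independence
   replaces it by an element of A. *)
have near l u : L l -> U u -> exists2 a, A a &
    b + b' - (u - l) <= a /\ a <= b + b' + (u - l).
  move=> Ll Uu; have h1 := Lg _ Ll; have h2 := gU _ Uu.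
  have h3 : - u < c' - b' by apply: Ug'; rewrite /= opprK.
  have h4 : c' - b' < - l by apply: g'L; rewrite /= opprK.
  have Dd : D (b + b') by exact: divsubD.
  have Dw : D (u - l) by apply: divsubB => //; [exact: UD|exact: LD].
  apply: (ind (c := c + c')); [exact: divsubB|exact: divsubD|exact: divsubD|dlra HM|dlra HM].
have [a1 Aa1 [/= L1 a1w]] : exists2 a, A a & L (- (a - b')) /\ a - b' <= - w.
  by apply: R2'; rewrite /= opprK.
have lt1 := LltU L1 Um0.
have [a Aa [ad1 ad2]] := near _ _ L1 Um0.
have Dl1 := LD L1.
(* As x - a1 is in A, the first obstruction keeps (x - a1) - b out of the part of [L] from [l0]
   on. *)
have inU x : A x -> l0 <= - (a1 - b') + (x - (b + b')) -> U (- (a1 - b') + (x - (b + b'))).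
  have -> : - (a1 - b') + (x - (b + b')) = (x - a1) - b by dlra HM.
  move=> Ax ge; have /DLU[h|//] : D (x - a1 - b) by do 2!apply: divsubB => //; exact: AD.
  have lt2 : x - a1 - b < l0 by apply: R1 => //; exact: divsubB.
  by exfalso; dlra HM.
have Ua : U (- (a1 - b') + (a - (b + b'))) by apply: inU => //; dlra HM.
have eta0 := LltU L1 Ua.
(* Let l1 = b' - a1 and eta = a - (b + b'), so that l1 is in [L] and l1 + eta in [U]. On whichever
   side l1 + eta/2 falls, one of the two half steps crosses the cut. *)
have [l [u [Ll Uu lu]]] : exists l u, [/\ L l, U u & (u - l) *+ 2 <= a - (b + b')].
  apply: contrapT => nlu.
  have nlu' l u : L l -> U u -> a - (b + b') < (u - l) *+ 2.
    by move=> Ll Uu; apply/(doag_leNgt HM) => h; apply: nlu; exists l, u.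
  have [h Dh h2] : exists2 h, D h & h *+ 2 = a - (b + b').
    by apply: divsub_div => //; apply: divsubB => //; [exact: AD|exact: divsubD].
  have Lh : L (- (a1 - b') + h).
    have /DLU[//|h'] : D (- (a1 - b') + h) by exact: divsubD.
    by have lt2 := nlu' _ _ L1 h'; exfalso; dlra HM.
  by have lt2 := nlu' _ _ Lh Ua; dlra HM.
have [a' Aa' [a'd1 a'd2]] := near _ _ Ll Uu.
have Ua' : U (- (a1 - b') + (a' - (b + b'))) by apply: inU => //; dlra HM.
have eta'0 := LltU L1 Ua'.
(* Let eta' = a' - (b + b'), which is positive and at most eta/2. The point l1 + eta - eta' of b' -
   A is too large for [L], as l1 + eta' is in [U], and in [U] it would have to exceed -m0, whereas
   l1 + eta does not. *)
have Aa2 : A (a1 - a + a') by apply: divsubD => //; exact: divsubB.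
have /DLU[h|h] : D (- ((a1 - a + a') - b')).
- by apply: divsubN => //; apply: divsubB => //; exact: AD.
- by have lt2 := LltU h Ua'; dlra HM.
- by have lt2 := R1' _ Aa2 h; dlra HM.
Qed.

Variable m : M.
Hypotheses (Lm : forall l, L l -> l < m) (mU : forall u, U u -> m < u).
Hypothesis right_end : forall c d, C c -> D d ->
  (forall l, L l -> l < c - d) -> (forall u, U u -> c - d < u) -> c - d < m.

(** For negative [k] the inequality says m <= (d - c)/|k|. By [right_end] this element of C + D is
    not in the cut, so some u in [U] is at most it, and d' = d - |k| u serves. *)
Lemma right_end_upper c d k : C c -> D d -> c <= d + m *~ k ->
  (exists2 d', D d' & c <= d' /\ d' <= d + m *~ k) \/
  (exists n, k = Posz n.+1 /\ forall d', D d' -> c <= d' -> d + m *~ k < d').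
Proof.
move=> Cc Dd cdk; have [?|nex] := pselect (exists2 d', D d' & c <= d' /\ d' <= d + m *~ k).
  by left.
right; case: k cdk nex => [[|n]|n] cdk nex.
- by exfalso; apply: nex; exists d => //; move: cdk; rewrite mulr0z addr0.
- exists n; split=> // d' Dd' cd'; apply/(doag_leNgt HM) => h.
  by apply: nex; exists d'.
exfalso; have n0 := ltn0Sn n.
have E : d + m *~ Negz n = d - m *+ n.+1 by [].
rewrite E in cdk nex.
have [c1 Cc1 c1E] := divsub_div HM CP n0 Cc.
have [d1 Dd1 d1E] := divsub_div HM DP n0 Dd.
have mv : m <= - c1 - - d1.
  by apply/(doag_lerMn HM _ _ n0); rewrite mulrnBl !mulNrn c1E d1E; dlra HM.
have [[u Uu uv]|nu] := pselect (exists2 u, U u & u <= - c1 - - d1).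
  apply: nex; exists (d - u *+ n.+1); first by apply: divsubB => //; apply: divsubMn => //; exact: UD.
  move/(doag_lerMn HM _ _ n0): uv; rewrite mulrnBl !mulNrn c1E d1E => uv.
  by move/(doag_ltrMn HM _ _ n0): (mU Uu) => mu; split; dlra HM.
have : - c1 - - d1 < m.
  apply: right_end => [||l /Lm lm|u Uu]; [exact: divsubN|exact: divsubN|dlra HM|].
  by apply/(doag_leNgt HM) => h; apply: nu; exists u.
by dlra HM.
Qed.

(** Division by the coefficient of [m] brings c - d into the cut, with b = d/(n+1) and l0 = (d' -
    d)/(n+1). The elements of A - b required in [U] come from cut independence on
    [d', d + (n+1) u]. *)
Lemma right_end_obstruction c d d' n : C c -> D d -> D d' ->
    d' <= c -> c <= d + m *+ n.+1 ->
    (forall d', D d' -> c <= d' -> d + m *+ n.+1 < d') ->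
    (forall a, A a -> d' <= a -> d + m *+ n.+1 < a) ->
  exists b l0 c, right_obstruction A C D L U b l0 c.
Proof.
move=> Cc Dd Dd' d'c cdm noD noA; have n0 := ltn0Sn n.
have [c1 Cc1 c1E] := divsub_div HM CP n0 Cc.
have [b Db bE] := divsub_div HM DP n0 Dd.
have [e De eE] := divsub_div HM DP n0 Dd'.
have c1m : c1 - b <= m by apply/(doag_lerMn HM _ _ n0); rewrite mulrnBl c1E bE; dlra HM.
have ec1 : e <= c1 by apply/(doag_lerMn HM _ _ n0); rewrite c1E eE.
exists b, (e - b), c1; split.
- split=> //; have /DLU[//|/mU h] : D (e - b) by exact: divsubB.
  by exfalso; dlra HM.
- move=> l Ll; apply/(doag_leNgt HM) => h.
  have := noD (d + l *+ n.+1); have := Lm Ll.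
  move/(doag_lerMn HM _ _ n0): h => h /(doag_ltrMn HM _ _ n0) h' h''.
  have {}h'' : d + m *+ n.+1 < d + l *+ n.+1.
    apply: h''; first by apply: divsubD => //; apply: divsubMn => //; exact: LD.
    by move: h; rewrite mulrnBl c1E bE; dlra HM.
  by dlra HM.
- by move=> u /mU mu; dlra HM.
- move=> a Aa /Lm am; apply/(doag_leNgt HM) => h.
  have := noA (a *+ n.+1) (divsubMn AP _ Aa).
  move/(doag_lerMn HM _ _ n0): h; rewrite !mulrnBl eE bE => h.
  move/(doag_ltrMn HM _ _ n0): am; rewrite mulrnBl bE => am h'.
  have {}h' : d + m *+ n.+1 < a *+ n.+1 by apply: h'; dlra HM.
  by dlra HM.
- move=> u Uu; have mu := mU Uu.
  move/(doag_ltrMn HM _ _ n0): (mu) => mun.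
  have [a Aa [a1 a2]] : exists2 a, A a & d' <= a /\ a <= d + u *+ n.+1.
    apply: (ind (c := c)) => //; last by dlra HM.
    by apply: divsubD => //; apply: divsubMn => //; exact: UD.
  have ha := noA _ Aa a1.
  have [a3 Aa3 a3E] := divsub_div HM AP n0 Aa.
  exists a3 => //; split.
    have /DLU[/Lm h|//] : D (a3 - b) by apply: divsubB => //; exact: AD.
    by move/(doag_ltrMn HM _ _ n0): h; rewrite mulrnBl a3E bE => h; exfalso; dlra HM.
  by apply/(doag_lerMn HM _ _ n0); rewrite mulrnBl a3E bE; dlra HM.
Qed.

(** [right_end_upper] is applied to the upper bound and to the negated lower bound. If both are
    replaced by elements of D, [ind] applies; if one is, a missing point of A is an obstruction; if
    none is, an element of D is found between the bounds all the same. *)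
Lemma right_end_independent :
    (forall b l0 c, ~ right_obstruction A C D L U b l0 c) ->
  forall c d1 d2 k1 k2, C c -> D d1 -> D d2 ->
    d1 + m *~ k1 <= c -> c <= d2 + m *~ k2 ->
  exists2 a, A a & d1 + m *~ k1 <= a /\ a <= d2 + m *~ k2.
Proof.
move=> nobs c d1 d2 k1 k2 Cc Dd1 Dd2 ge le; apply: contrapT => noA.
have noA' a : A a -> ~ (d1 + m *~ k1 <= a /\ a <= d2 + m *~ k2).
  by move=> Aa h; apply: noA; exists a.
have ge' : - c <= - d1 + m *~ (- k1) by rewrite mulrNz; dlra HM.
have Nd1 : D (- d1) by exact: divsubN.
have Nc : C (- c) by exact: divsubN.
case: (right_end_upper Cc Dd2 le) => [[d Dd [cd dle]]|[n [k2E noD]]];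
case: (right_end_upper Nc Nd1 ge') => [[d' Dd' [cd' d'le]]|[n' [k1E noD']]].
- have [|||a Aa [h1 h2]] := ind (d1 := - d') (d2 := d) _ Dd Cc; [exact: divsubN|dlra HM|exact: cd|].
  by apply: (noA' a Aa); move: d'le; rewrite mulrNz; split; dlra HM.
- have [] := @right_end_obstruction (- c) (- d1) (- d) n' => //.
  + exact: divsubN.
  + by dlra HM.
  + by rewrite -[m *+ _]/(m *~ Posz n'.+1) -k1E.
  + by rewrite -[m *+ _]/(m *~ Posz n'.+1) -k1E.
  + move=> a Aa da; apply/(doag_leNgt HM) => h; apply: (noA' (- a)); first exact: divsubN.
    by move: h; rewrite -[m *+ _]/(m *~ Posz n'.+1) -k1E mulrNz; split; dlra HM.
  + by move=> b [l0 [c0]] /nobs.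
- have [] := @right_end_obstruction c d2 (- d') n => //.
  + exact: divsubN.
  + by dlra HM.
  + by rewrite -[m *+ _]/(m *~ Posz n.+1) -k2E.
  + by rewrite -[m *+ _]/(m *~ Posz n.+1) -k2E.
  + move=> a Aa da; apply/(doag_leNgt HM) => h; apply: (noA' a) => //.
    by move: h d'le; rewrite -[m *+ _]/(m *~ Posz n.+1) -k2E mulrNz; split; dlra HM.
  + by move=> b [l0 [c0]] /nobs.
- (* The weighted mean of the two bounds that eliminates [m] lies in D. *)
  have N0 : (0 < n.+1 + n'.+1)%N by [].
  have [p Dp pE] : exists2 p, D p & p *+ (n.+1 + n'.+1) = d1 *+ n.+1 + d2 *+ n'.+1.
    by apply: divsub_div => //; apply: divsubD => //; exact: divsubMn.
  have {}k1E : k1 = - Posz n'.+1 by rewrite -k1E opprK.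
  move: ge le noD noD'; rewrite k1E k2E opprK !mulrNz -![m *~ Posz _]/(m *+ _).
  move=> ge le noD noD'.
  have pE' : p *+ (n.+1 + n'.+1) = (d1 - m *+ n'.+1) *+ n.+1 + (d2 + m *+ n.+1) *+ n'.+1.
    rewrite pE mulrnBl mulrnDl -!mulrnA [(n'.+1 * _)%N]mulnC.
    by dlra HM.
  have h : d1 - m *+ n'.+1 <= d2 + m *+ n.+1 by exact: le_trans le.
  have p1 : d1 - m *+ n'.+1 <= p.
    apply/(doag_lerMn HM _ _ N0); rewrite pE' mulrnDr.
    by move/(doag_lerMn HM _ _ (ltn0Sn n')): h; dlra HM.
  have p2 : p <= d2 + m *+ n.+1.
    apply/(doag_lerMn HM _ _ N0); rewrite pE' mulrnDr.
    by move/(doag_lerMn HM _ _ (ltn0Sn n)): h; dlra HM.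
  case: (doag_total HM c p) => cp.
    by have := noD _ Dp cp; dlra HM.
  have cp' : - c <= - p by dlra HM.
  by have := noD' _ (divsubN DP Dp) cp'; dlra HM.
Qed.

End OneCut.

(** * Embeddings of models *)

Section Embedding.
Variables (M N : porderZmodType) (j : M -> N).
Hypotheses (HM : is_DOAG M) (HN : is_DOAG N) (jP : embedding j).

Lemma embD x y : j (x + y) = j x + j y. Proof. by case: jP. Qed.
Lemma emb0 : j 0 = 0.
Proof. by apply: (@addIr _ (j 0)); rewrite -embD !add0r. Qed.
Lemma embN x : j (- x) = - j x.
Proof. by apply: (@addrI _ (j x)); rewrite -embD !subrr emb0. Qed.
Lemma embB x y : j (x - y) = j x - j y. Proof. by rewrite embD embN. Qed.
Lemma embMn x n : j (x *+ n) = j x *+ n.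
Proof. by elim: n => [|n IH]; rewrite ?mulr0n ?emb0 // !mulrS embD IH. Qed.
Lemma emb_lt x y : j x < j y <-> x < y.
Proof.
split; last by case: jP => _; apply.
move=> jxy; apply/(doag_leNgt HM); rewrite le_eqVlt => /orP[/eqP e|].
  by move: jxy; rewrite e ltxx.
by case: jP => _ h /h h'; have := lt_trans jxy h'; rewrite ltxx.
Qed.
Lemma emb_le x y : j x <= j y <-> x <= y.
Proof. by rewrite -(doag_ltNge HN (j y)) -(doag_ltNge HM y) emb_lt. Qed.
Lemma emb_teval V (e : V -> M) t : teval (j \o e) t = j (teval e t).
Proof. by elim: t => //= [|t -> u ->|t ->]; rewrite ?emb0 ?embD ?embN. Qed.
Lemma emb_agree V (e : V -> M) : agree e (j \o e).
Proof. by move=> t; rewrite emb_teval; split; rewrite -emb0 emb_lt. Qed.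

Lemma divsub_image S : divsub S -> divsub (j @` S).
Proof.
move=> SP; split=> [|_ _ [x Sx <-] [y Sy <-]|x n n0 [y Sy yE]].
- by exists 0; [exact: divsub0|exact: emb0].
- by exists (x - y); [exact: divsubB|exact: embB].
- have [z Sz zE] := divsub_div HM SP n0 Sy; exists z => //.
  by apply: (doag_mulIrn HN n0); rewrite -embMn zE.
Qed.

Lemma cut_independent_image A C D :
  cut_independent A C D -> cut_independent (j @` A) (j @` C) (j @` D).
Proof.
move=> ind _ _ _ [d1 D1 <-] [d2 D2 <-] [c Cc <-] /emb_le h1 /emb_le h2.
by have [a Aa [a1 a2]] := ind _ _ _ D1 D2 Cc h1 h2; exists (j a);
  [exists a|split; apply/emb_le].
Qed.

End Embedding.

Lemma embedding_comp (M N P : porderZmodType) (i : M -> N) (j : N -> P) :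
  embedding i -> embedding j -> embedding (j \o i).
Proof.
by case=> iD il [jD jl]; split=> [x y|x y xy] /=; [rewrite iD jD|apply/jl/il].
Qed.

(** The candidates [mR] and [mL], right and left of the elements of C + D in the cut, are placed in
    one extension. Without a right obstruction [mR] serves; otherwise [no_two_obstructions] excludes
    left ones, and [mL] serves by the same argument after negation. *)
Lemma place_in_cut (N : porderZmodType) (A C D L U : set N) :
    is_DOAG N -> divsub A -> divsub C -> divsub D -> A `<=` D ->
    (forall x, D x <-> L x \/ U x) -> (forall l u, L l -> U u -> l < u) ->
    cut_independent A C D ->
  exists (N' : porderZmodType) (j : N -> N') (m : N'),
    [/\ is_DOAG N', embedding j, forall l, L l -> j l < m, forall u, U u -> m < j u &
      forall c d1 d2 k1 k2, C c -> D d1 -> D d2 ->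
        j d1 + m *~ k1 <= j c -> j c <= j d2 + m *~ k2 ->
      exists2 a, A a & j d1 + m *~ k1 <= j a /\ j a <= j d2 + m *~ k2].
Proof.
move=> HN AP CP DP AD DLU LU ind.
pose G := [set v | (exists c d, [/\ C c, D d & v = c - d]) /\
  ((forall l, L l -> l < v) /\ (forall u, U u -> v < u))].
have [|N1 [j1 [mR [H1 j1P LmR mRU]]]] := @cut_realization _ (L `|` G) U HN.
  by move=> x y [Lx|[_ [_ Gx]]] Uy; [exact: LU|exact: Gx].
have [|N2 [j2 [mL [H2 j2P LmL mLU]]]] := @cut_realization _ (j1 @` L) (j1 @` (U `|` G)) H1.
  move=> _ _ [l Ll <-] [u [Uu|[_ [Gu _]]] <-]; apply/(emb_lt HN j1P); [exact: LU|exact: Gu].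
pose j := j2 \o j1; have jP : embedding j := embedding_comp j1P j2P.
have jind := cut_independent_image HN H2 jP ind.
have jAP := divsub_image HN H2 jP AP; have jCP := divsub_image HN H2 jP CP.
have jDP := divsub_image HN H2 jP DP.
have jAD : j @` A `<=` j @` D by apply: image_subset.
have jDLU x : (j @` D) x <-> (j @` L) x \/ (j @` U) x.
  split=> [[y /DLU[h|h] <-]|[[y h <-]|[y h <-]]];
    by [left; exists y|right; exists y|exists y => //; apply/DLU; left|exists y => //; apply/DLU; right].
have jLU l u : (j @` L) l -> (j @` U) u -> l < u.
  by move=> [x Lx <-] [y Uy <-]; apply/(emb_lt HN jP); exact: LU.
have jG x : (exists c d, [/\ (j @` C) c, (j @` D) d & x = c - d]) ->
    (forall l, (j @` L) l -> l < x) -> (forall u, (j @` U) u -> x < u) -> exists2 v, G v & x = j v.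
  move=> [_ [_ [[c Cc <-] [d Dd <-] xE]]] Lx xU; rewrite -(embB jP) in xE.
  exists (c - d) => //; split; first by exists c, d.
  split=> [l Ll|u Uu]; apply/(emb_lt HN jP); rewrite -xE; [apply: Lx|apply: xU].
    by exists l.
  by exists u.
pose LN := [set x | (j @` U) (- x)]; pose UN := [set x | (j @` L) (- x)].
have [noR|] := pselect (forall b l0 c,
    ~ right_obstruction (j @` A) (j @` C) (j @` D) (j @` L) (j @` U) b l0 c).
  exists N2, j, (j2 mR); split=> // [l Ll|u Uu|c d1 d2 k1 k2 Cc Dd1 Dd2 h1 h2].
  - by apply/(emb_lt H1 j2P)/LmR; left.
  - exact/(emb_lt H1 j2P)/mRU.
  have [] := @right_end_independent N2 _ _ _ _ _ H2 jAP jCP jDP jAD jDLU jind (j2 mR)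
     _ _ _ noR (j c) (j d1) (j d2) k1 k2 (imageP j Cc) (imageP j Dd1) (imageP j Dd2) h1 h2.
  + by move=> _ [l Ll <-]; apply/(emb_lt H1 j2P)/LmR; left.
  + by move=> _ [u Uu <-]; apply/(emb_lt H1 j2P)/mRU.
  + move=> c' d' Cc' Dd' h3 h4; have [v Gv ->] : exists2 v, G v & c' - d' = j v by apply: jG => //; exists c', d'.
    by apply/(emb_lt H1 j2P)/LmR; right.
  + by move=> _ [a Aa <-] h; exists a.
move=> /existsNP[b /existsNP[l0 /existsNP[c0 /contrapT obR]]].
have noL b' m0 c' : ~ right_obstruction (j @` A) (j @` C) (j @` D) LN UN b' m0 c'.
  move=> obL; have jLUN l u : LN l -> UN u -> l < u.
    by move=> h1 h2; have := jLU _ _ h2 h1; dlra H2.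
  have jDN x : (j @` D) x <-> LN x \/ UN x.
    split=> [/(divsubN jDP)/jDLU[h|h]|h]; [by right|by left|].
    by rewrite -[x]opprK; apply/(divsubN jDP)/jDLU; case: h; [right|left].
  (* The side of the cut on which the middle of l0 and -m0 falls decides which obstruction is taken
     as the first. *)
  have [w Dw wE] : exists2 w, (j @` D) w & w *+ 2 = l0 - m0.
    apply: (divsub_div H2 jDP) => //; apply: divsubB => //.
      by apply/jDLU; case: obR => -[_ _]; left.
    by apply/jDN; case: obL => -[_ _]; left.
  case/jDLU: Dw => h; first exact: (no_two_obstructions H2 jAP jCP jDP jAD jDLU jLU jind obR obL wE h).
  apply: (@no_two_obstructions _ _ _ _ LN UN H2 jAP jCP jDP jAD jDN jLUN jind _ _ _ _ _ _ (- w) obL).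
  - by move: obR; congr right_obstruction; apply/seteqP; split=> x; rewrite /LN /UN /= opprK.
  - by dlra H2.
  - by rewrite /LN /= opprK.
exists N2, j, mL; split=> // [l Ll|u Uu|c d1 d2 k1 k2 Cc Dd1 Dd2 h1 h2].
- by apply: LmL; exists l.
- by apply: mLU; exists u => //; left.
have [] := @right_end_independent N2 _ _ _ _ _ H2 jAP jCP jDP jAD _ jind (- mL)
   _ _ _ noL (j c) (j d1) (j d2) (- k1) (- k2) (imageP j Cc) (imageP j Dd1) (imageP j Dd2).
+ move=> x; split=> [/(divsubN jDP)/jDLU[h|h]|h]; [by right|by left|].
  by rewrite -[x]opprK; apply/(divsubN jDP)/jDLU; case: h; [right|left].
+ move=> l [u Uu uE]; have : mL < - l by rewrite -uE; apply: mLU; exists u => //; left.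
  by dlra H2.
+ move=> u [l Ll lE]; have : - u < mL by rewrite -lE; apply: LmL; exists l.
  by dlra H2.
+ move=> c' d' Cc' Dd' h3 h4.
  have [v Gv vE] : exists2 v, G v & - (c' - d') = j v.
    apply: jG.
  * exists (- c'), (- d'); split; [exact: divsubN|exact: divsubN|by dlra H2].
  * by move=> l Ll; have : c' - d' < - l; [apply: h4; rewrite /UN /= opprK|dlra H2].
  * by move=> u Uu; have : - u < c' - d'; [apply: h3; rewrite /LN /= opprK|dlra H2].
  have : mL < - (c' - d') by rewrite vE; apply: mLU; exists v => //; right.
  by dlra H2.
+ by rewrite mulrNz mulNrz opprK.
+ by rewrite mulrNz mulNrz opprK.
+ by move=> _ [a Aa <-]; rewrite !mulrNz !mulNrz !opprK; exists a.
Qed.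

(** * Moving the parameters of dividing formulas *)

(** The divisible hull of a family rather than of a set: its elements come with a term, which can be
    evaluated in another model under an agreeing environment. *)
Definition dspan (M : porderZmodType) V (e : V -> M) : set M :=
  [set x | exists n (t : term V), (0 < n)%N /\ x *+ n = teval e t].

Lemma dspan_teval (M : porderZmodType) V (e : V -> M) t : dspan e (teval e t).
Proof. by exists 1, t; rewrite mulr1n. Qed.

Lemma dspan_divsub (M : porderZmodType) V (e : V -> M) : divsub (dspan e).
Proof.
split=> [|x y [n [t [n0 xt]]] [m [u [m0 yu]]]|x n n0 [m [t [m0 xt]]]].
- exact: (dspan_teval e (TZero V)).
- exists (n * m)%N, (TAdd (tmuln t m) (TOpp (tmuln u n))); split; first by rewrite muln_gt0 n0.
  by rewrite /= !teval_muln -xt -yu mulrnBl mulrnA [(n * m)%N]mulnC mulrnA.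
- exists (n * m)%N, t; split; first by rewrite muln_gt0 n0.
  by rewrite mulrnA.
Qed.

Lemma dspan_sub (M : porderZmodType) V W (e : V -> M) (e' : W -> M) :
  (forall v, dspan e' (e v)) -> dspan e `<=` dspan e'.
Proof.
move=> ee' x [n [t [n0 xt]]]; have SP := dspan_divsub e'; case: (SP) => _ _ /(_ x n n0); apply.
rewrite xt; elim: t {xt} => //= [|t IH u IH'|t IH]; first exact: divsub0.
  exact: divsubD.
exact: divsubN.
Qed.

Lemma dspan_embedding (M N : porderZmodType) V (e : V -> M) (j : M -> N) :
  is_DOAG M -> is_DOAG N -> embedding j -> dspan (j \o e) = j @` dspan e.
Proof.
move=> HM HN jP; apply/seteqP; split=> [x [n [t [n0 xt]]]|_ [x [n [t [n0 xt]]] <-]].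
  have [y yt] := doag_div HM (teval e t) n0; exists y; first by exists n, t.
  by apply: (doag_mulIrn HN n0); rewrite -(embMn jP) yt xt (emb_teval jP).
by exists n, t; split=> //; rewrite (emb_teval jP) -(embMn jP) xt.
Qed.

Lemma same_sign_trans (M N P : porderZmodType) (x : M) (y : N) (z : P) :
  same_sign x y -> same_sign y z -> same_sign x z.
Proof. by move=> [h1 h2] [h3 h4]; split; [rewrite h1|rewrite h2]. Qed.

(** If [d] and [d'] were on different sides of [c], cut independence would give an element of A
    between them, which tells them apart. *)
Lemma cut_independent_same_sign (N : porderZmodType) (A C D : set N) c d d' :
    is_DOAG N -> cut_independent A C D -> C c -> D d -> D d' ->
    (forall a, A a -> same_sign (d - a) (d' - a)) ->
  same_sign (d - c) (d' - c).
Proof.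
move=> HN ind Cc Dd Dd' dd'.
have half x y : D x -> D y -> (forall a, A a -> same_sign (x - a) (y - a)) ->
    (0 < x - c -> 0 < y - c) /\ (x - c < 0 -> y - c < 0).
  move=> Dx Dy xy; split=> h.
    apply/(doag_leNgt HN) => h'.
    have [||a Aa [a1 a2]] := ind _ _ _ Dy Dx Cc; [dlra HN|dlra HN|].
    have [hp hn] := xy a Aa.
    case: (doag_ltgt HN 0 (x - a)) => [ax|xa|ax]; [have := hp.1 ax; dlra HN| |dlra HN].
    by have /esym ya := (same_sign_eq0 HN HN (xy a Aa)).1 (esym xa); dlra HN.
  apply/(doag_leNgt HN) => h'.
  have [||a Aa [a1 a2]] := ind _ _ _ Dx Dy Cc; [dlra HN|dlra HN|].
  have [hp hn] := xy a Aa.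
  case: (doag_ltgt HN 0 (y - a)) => [ay|ya|ay]; [have := hp.2 ay; dlra HN| |dlra HN].
  by have /esym xa := (same_sign_eq0 HN HN (xy a Aa)).2 (esym ya); dlra HN.
have h1 := half _ _ Dd Dd' dd'; have h2 : forall a, A a -> same_sign (d' - a) (d - a).
  by move=> a /dd' /same_sign_sym.
by have h3 := half _ _ Dd' Dd h2; split; split; by [apply: h1.1|apply: h1.2|apply: h3.1|apply: h3.2].
Qed.

(** One step of a back-and-forth. If [m] is in the span, its partner is determined and the span does
    not grow; otherwise [place_in_cut] provides a partner in the corresponding cut. *)
Lemma extend_env (M N : porderZmodType) V (e : V -> M) (e' : V -> N) (A C : set N) (m : M) :
    is_DOAG M -> is_DOAG N -> agree e e' -> divsub A -> divsub C -> A `<=` dspan e' ->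
    cut_independent A C (dspan e') ->
  exists (N' : porderZmodType) (j : N -> N') (m' : N'),
    [/\ is_DOAG N', embedding j, agree (oenv e m) (oenv (j \o e') m') &
      cut_independent (j @` A) (j @` C) (dspan (oenv (j \o e') m'))].
Proof.
move=> HM HN agr AP CP Ae' ind.
have [[n [t [n0 mt]]]|mN] := pselect (dspan e m).
  have [m' m't] := doag_div HN (teval e' t) n0.
  exists N, id, m'; split=> //.
  - move=> u; have [k [s us]] := tsplit u; rewrite !us.
    apply/(@same_sign_mulrn _ _ _ _ n) => //; rewrite !mulrnDl.
    have comm (P : porderZmodType) (x : P) : x *~ k *+ n = (x *+ n) *~ k.
      by rewrite !pmulrn -!mulrzA mulrC.
    rewrite !comm mt m't.
    by have := agr (TAdd (tmulz t k) (tmuln s n)); rewrite /= !teval_mulz !teval_muln.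
  - rewrite !image_id => d1 d2 c Dd1 Dd2; apply: ind.
      by apply: dspan_sub Dd1 => -[v|]; [exact: (dspan_teval e' (TVar v))|exists n, t].
    by apply: dspan_sub Dd2 => -[v|]; [exact: (dspan_teval e' (TVar v))|exists n, t].
(* The cut of [m] over the span of [e], transported along terms to the span of [e']. *)
pose L := [set x | exists n t, [/\ (0 < n)%N, x *+ n = teval e' t & teval e t < m *+ n]].
pose U := [set x | exists n t, [/\ (0 < n)%N, x *+ n = teval e' t & m *+ n < teval e t]].
have DLU x : dspan e' x <-> L x \/ U x.
  split=> [[n [t [n0 xt]]]|[|] [n [t [n0 xt _]]]]; [|by exists n, t|by exists n, t].
  case: (doag_ltgt HM (teval e t) (m *+ n)) => h; [by left; exists n, t| |by right; exists n, t].
  by case: mN; exists n, t.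
have LU l u : L l -> U u -> l < u.
  move=> [n [t [n0 lt tm]]] [p [s [p0 us ms]]].
  have np0 : (0 < n * p)%N by rewrite muln_gt0 n0.
  apply/(doag_ltrMn HN _ _ np0); rewrite mulrnA lt mulnC mulrnA us.
  have := (agr (TAdd (tmuln s n) (TOpp (tmuln t p)))).1.
  rewrite /= !teval_muln !doag_subr_gt0 // => <-.
  apply: (@lt_trans _ _ (m *+ (n * p))); first by rewrite mulrnA; apply/(doag_ltrMn HM).
  by rewrite mulnC mulrnA; apply/(doag_ltrMn HM).
have [N' [j [m' [HN' jP Lm mU ind']]]] :=
  place_in_cut HN AP CP (dspan_divsub e') Ae' DLU LU ind.
exists N', j, m'; split=> //.
(* The sign of (n+1) m + s tells on which side of [m] the element -s/(n+1) lies; equality is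
   excluded because [m] is outside the span. *)
- have pos n s : same_sign (m *+ n.+1 + teval e s) (m' *+ n.+1 + teval (j \o e') s).
    have n0 := ltn0Sn n; have [y ys] := doag_div HN (- teval e' s) n0.
    have jys : j y *+ n.+1 = - j (teval e' s) by rewrite -(embMn jP) ys (embN jP).
    rewrite (emb_teval jP); split.
      have [h|h] := pselect (- teval e s < m *+ n.+1).
        have /Lm /(doag_ltrMn HN' _ _ n0) : L y by exists n.+1, (TOpp s).
        by rewrite jys => h'; split=> _; [dlra HN'|dlra HM].
      have /(doag_ltNge HM) h' := h.
      have /mU /(doag_ltrMn HN' _ _ n0) : U y.
        exists n.+1, (TOpp s); split=> //=; rewrite lt_neqAle h' andbT.
        by apply/eqP => e0; apply: mN; exists n.+1, (TOpp s).
      by rewrite jys => h2; split=> h3; exfalso; [dlra HM|dlra HN'].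
    have [h|h] := pselect (- teval e s < m *+ n.+1).
      have /Lm /(doag_ltrMn HN' _ _ n0) : L y by exists n.+1, (TOpp s).
      by rewrite jys => h2; split=> h3; exfalso; [dlra HM|dlra HN'].
    have /(doag_ltNge HM) h' := h.
    have {}h' : m *+ n.+1 < - teval e s.
      rewrite lt_neqAle h' andbT.
      by apply/eqP => e0; apply: mN; exists n.+1, (TOpp s).
    have /mU /(doag_ltrMn HN' _ _ n0) : U y by exists n.+1, (TOpp s).
    by rewrite jys => h2; split=> _; [dlra HN'|dlra HM].
  move=> u; have [k [s us]] := tsplit u; rewrite !us.
  case: k us => [[|n]|n] us; [|exact: pos|].
    rewrite !mulr0z !add0r; apply: same_sign_trans (agr s) _.
    exact: emb_agree.
  have := same_signN HM HN' (pos n (TOpp s)).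
  rewrite /= !opprD !opprK; exact.
(* Multiplication by n1 n2 clears denominators and gives both bounds the form treated by [ind']. *)
- move=> d1 d2 _ [n1 [t1 [n10 d1E]]] [n2 [t2 [n20 d2E]]] [c Cc <-] h1 h2.
  have n0 : (0 < n1 * n2)%N by rewrite muln_gt0 n10.
  have [k1 [s1 s1E]] := tsplit t1; have [k2 [s2 s2E]] := tsplit t2.
  have comm (P : porderZmodType) (x : P) k n : x *~ k *+ n = x *~ (k * n%:Z).
    by rewrite pmulrn -mulrzA.
  have E1 : d1 *+ (n1 * n2) = j (teval e' s1 *+ n2) + m' *~ (k1 * n2%:Z).
    by rewrite mulrnA d1E s1E mulrnDl comm addrC (emb_teval jP) (embMn jP).
  have E2 : d2 *+ (n1 * n2) = j (teval e' s2 *+ n1) + m' *~ (k2 * n1%:Z).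
    by rewrite mulnC mulrnA d2E s2E mulrnDl comm addrC (emb_teval jP) (embMn jP).
  have [||||a Aa [a1 a2]] := ind' (c *+ (n1 * n2)) (teval e' s1 *+ n2) (teval e' s2 *+ n1)
      (k1 * n2%:Z) (k2 * n1%:Z) (divsubMn CP _ Cc).
  + exact: (divsubMn (dspan_divsub e') _ (dspan_teval e' _)).
  + exact: (divsubMn (dspan_divsub e') _ (dspan_teval e' _)).
  + by rewrite -E1 (embMn jP); apply/(doag_lerMn HN').
  + by rewrite -E2 (embMn jP); apply/(doag_lerMn HN').
  have [a0 Aa0 aE] := divsub_div HN AP n0 Aa.
  exists (j a0); first by exists a0.
  by split; apply/(doag_lerMn HN' _ _ n0); rewrite -(embMn jP) aE ?E1 ?E2.
Qed.

(** Variables are only added, and [i] traces the old ones: parameters already named keep their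
    partners up to [j], while the elements of [ms] receive new ones. *)
Lemma extend_env_seq (M : porderZmodType) (HM : is_DOAG M) (ms : seq M) :
  forall (N : porderZmodType) V (e : V -> M) (e' : V -> N) (A C : set N),
    is_DOAG N -> agree e e' -> divsub A -> divsub C -> A `<=` dspan e' ->
    cut_independent A C (dspan e') ->
  exists (N' : porderZmodType) (j : N -> N') W (f : W -> M) (f' : W -> N') (i : V -> W),
    [/\ is_DOAG N', embedding j, agree f f',
      [/\ f \o i =1 e, f' \o i =1 j \o e' & forall x, x \in ms -> exists w, f w = x] &
      cut_independent (j @` A) (j @` C) (dspan f')].
Proof.
elim: ms => [|m ms IH] N V e e' A C HN agr AP CP Ae' ind.
  by exists N, id, V, e, e', id; split; rewrite ?image_id.
have [N1 [j1 [m' [HN1 j1P agr1 ind1]]]] := extend_env m HM HN agr AP CP Ae' ind.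
have [||| N2 [j2 [W [f [f' [i [HN2 j2P agr2 [fi f'i msf] ind2]]]]]]] :=
   IH N1 _ _ _ _ _ HN1 agr1 _ _ _ ind1; [exact: divsub_image|exact: divsub_image| |].
  move=> _ [a /Ae' h <-]; have : dspan (j1 \o e') (j1 a) by rewrite dspan_embedding //; exists a.
  by apply: dspan_sub => v; exact: (dspan_teval (oenv _ _) (TVar (Some v))).
exists N2, (j2 \o j1), W, f, f', (i \o Some); split=> //.
- exact: embedding_comp.
- split=> [v|v|x]; [exact: fi (Some v)|exact: f'i (Some v)|].
  rewrite inE => /orP[/eqP->|/msf //]; exists (i None); exact: fi None.
- by rewrite !image_comp in ind2.
Qed.

(** * Terms over sets of parameters, and their finite supports *)

Lemma tsplit_join U V (t : term (U + V)) : exists (r : term U) (s : term V),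
  forall (M : porderZmodType) (a : U -> M) (b : V -> M),
    teval (join_env a b) t = teval a r + teval b s.
Proof.
elim: t => [[u|v]||t [r [s h]] t' [r' [s' h']]|t [r [s h]]].
- by exists (TVar u), (TZero V) => M a b; rewrite /= addr0.
- by exists (TZero U), (TVar v) => M a b; rewrite /= add0r.
- by exists (TZero U), (TZero V) => M a b; rewrite /= add0r.
- by exists (TAdd r r'), (TAdd s s') => M a b; rewrite /= h h' addrACA.
- by exists (TOpp r), (TOpp s) => M a b; rewrite /= h opprD.
Qed.

Lemma set_val_surj (T : Type) (S : set T) x : S x -> exists y : S, set_val y = x.
Proof. by move=> Sx; exists (SigSub (mem_set Sx)). Qed.

Lemma set_val_in (T : Type) (S : set T) (y : S) : S (set_val y).
Proof. exact: set_valP. Qed.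

Lemma gen_subgroupE (M : porderZmodType) (S : set M) x :
  gen_subgroup S x <-> exists t : term S, x = teval set_val t.
Proof.
split=> [/(_ [set y | exists t : term S, y = teval set_val t]) h|[t ->]].
  apply: h; split.
    split; first by exists (TZero S).
    by move=> _ _ [t ->] [u ->]; exists (TAdd t (TOpp u)).
  by move=> y Sy; have [z <-] := set_val_surj Sy; exists (TVar z).
move=> H [[H0 HB] SH]; elim: t => [v||t IH u IH'|t IH] //=.
- by apply: SH; exact: set_val_in.
- rewrite -[teval _ u]opprK; apply: (HB _ _ IH).
  by rewrite -[- _]add0r; apply: HB.
- by rewrite -[- _]add0r; apply: HB.
Qed.

Lemma dcl_genE (M : porderZmodType) (S : set M) : dcl_gen S = dspan (@set_val M S).
Proof.
apply/seteqP; split=> [x [n [n0 /gen_subgroupE[t xt]]]|x [n [t [n0 xt]]]].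
  by exists n, t.
by exists n; split=> //; apply/gen_subgroupE; exists t.
Qed.

Lemma dcl_gen_divsub (M : porderZmodType) (S : set M) : divsub (dcl_gen S).
Proof. by rewrite dcl_genE; exact: dspan_divsub. Qed.

Lemma dcl_gen_sub (M : porderZmodType) (S T : set M) : S `<=` T -> dcl_gen S `<=` dcl_gen T.
Proof.
move=> ST; rewrite !dcl_genE; apply: dspan_sub => v.
have [w <-] := set_val_surj (ST _ (set_val_in v)); exact: (dspan_teval _ (TVar w)).
Qed.

Lemma term_finite_support (M : porderZmodType) (S : set M) (t : term S) :
  exists p (par : 'I_p -> M) (s : term 'I_p),
    (forall i, S (par i)) /\ teval set_val t = teval par s.
Proof.
elim: t => [v||t [p [par [s [parS E]]]] u [p' [par' [s' [parS' E']]]]|t [p [par [s [parS E]]]]].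
- by exists 1, (fun=> set_val v), (TVar ord0); split=> // _; exact: set_val_in.
- exists 0, (fun=> 0), (TZero _); split=> //; case=> //.
- pose f (i : 'I_(p + p')) := match fintype.split i with inl j => par j | inr j => par' j end.
  exists (p + p')%N, f, (TAdd (trename (lshift p') s) (trename (@rshift p p') s')); split.
    by move=> i; rewrite /f; case: fintype.split.
  rewrite /= !teval_rename E E'; congr (_ + _); apply: teval_ext => i /=.
    by rewrite /f; have := unsplitK (inl i : 'I_p + 'I_p'); rewrite /= => ->.
  by rewrite /f; have := unsplitK (inr i : 'I_p + 'I_p'); rewrite /= => ->.
- by exists p, par, (TOpp s); rewrite /= E.
Qed.

Lemma InE (T : eqType) (x : T) s : List.In x s <-> x \in s.
Proof.
elim: s => //= a s IH; rewrite inE; split=> [[->|/IH->]|/orP[/eqP->|/IH h]];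
  by [rewrite eqxx|rewrite orbT|left|right].
Qed.

Lemma In_mapP (T U : Type) (f : T -> U) y s :
  List.In y (map f s) -> exists2 x, List.In x s & f x = y.
Proof.
elim: s => //= a s IH [<-|/IH[x xs <-]]; first by exists a => //; left.
by exists x => //; right.
Qed.

Definition join_rename X V W (h : V -> W) (v : X + V) : X + W :=
  match v with inl x => inl x | inr v => inr (h v) end.

Lemma sat_join_rename (M : porderZmodType) X V W (h : V -> W) (x : X -> M) (e : W -> M) f :
  sat (join_env x e) (frename (join_rename h) f) <-> sat (join_env x (e \o h)) f.
Proof. by rewrite sat_rename; apply: sat_ext => -[]. Qed.

Lemma sat_all_transfer (M N : porderZmodType) X W (fs : seq (formula (X + W)))
    (e : W -> M) (e' : W -> N) (y : X -> N) :
  is_DOAG M -> is_DOAG N -> agree e e' ->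
  (forall f, List.In f fs -> sat (join_env y e') f) ->
  exists x : X -> M, forall f, List.In f fs -> sat (join_env x e) f.
Proof.
move=> HM HN agr sy.
pose F := foldr (@FAnd _) (FEq (TZero (X + W)) (TZero _)) fs.
have FE (P : porderZmodType) (z : X + W -> P) :
    sat z F <-> forall f, List.In f fs -> sat z f.
  rewrite /F; elim: (fs) => [|f l IH] /=; first by split.
  by rewrite IH; split=> [[h h'] g [<-|]|h]; [|exact: h'|split=> [|g gl]; apply: h; [left|right]].
have [x /FE xP] := sat_ex_transfer HM HN agr ((FE _ _).2 sy).
by exists x.
Qed.

(** Inconsistency is finitary, hence witnessed by a list [js] of positions; only these and position
    0 have to be moved later. *)
Lemma divides_witness (M : porderZmodType) X (A : set M) (q : pformula M X) :
  divides A q -> exists (b : nat -> 'I_(pf_arity q) -> M) (js : seq nat),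
    [/\ b 0%N = pf_par q, indiscernible A b &
      forall c : X -> M, ~ forall k, k \in js -> sat (join_env c (b k)) (pf_form q)].
Proof.
move=> [b [b0 bA incons]]; have [r [rP [c cP]]] : exists r : seq (pformula M X),
    (forall q', List.In q' r -> exists k, PFormula (pf_form q) (b k) = q') /\
    True /\ forall c, ~ forall q', List.In q' r -> psat c q'.
  apply: contrapT => nr; apply: incons => n r rP.
  apply: contrapT => nc; apply: nr; exists [seq r i | i <- enum 'I_n]; split.
    have : forall i, i \in enum 'I_n -> exists k, PFormula (pf_form q) (b k) = r i.
      by move=> i _; have [k _ kE] := rP i; exists k.
    elim: (enum 'I_n) => //= i l IH h q' [<-|]; first by apply: h; rewrite mem_head.
    by apply: IH => i' il; apply: h; rewrite inE il orbT.
  split=> // c cP; apply: nc; exists c => i; apply: cP; apply: In_map.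
  by apply/InE; rewrite mem_enum.
exists b.
have [js jsP] : exists js : seq nat, forall q', List.In q' r ->
    exists2 k, k \in js & PFormula (pf_form q) (b k) = q'.
  elim: (r) rP => [|q' l IH] h; first by exists [::].
  have [js jsP] : exists js : seq nat, forall q', List.In q' l ->
      exists2 k, k \in js & PFormula (pf_form q) (b k) = q'.
    by apply: IH => q'' ql; apply: h; right.
  have [k kE] := h q' (or_introl erefl); exists (k :: js) => q'' /= [<-|/jsP[k' k'j k'E]].
    by exists k; rewrite ?mem_head.
  by exists k'; rewrite // inE k'j orbT.
exists js; split=> // x xP; apply: (cP x) => q' /jsP[k kj <-].
exact: xP.
Qed.

(** * Cut independence implies non-forking *)

Section NonForking.
Variables (M : porderZmodType) (A B C : set M).
Hypothesis HM : is_DOAG M.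

(** Subsequences of length one suffice: all members of the sequence have the same type over A, and
    the denominator of [a] can be cleared. *)
Lemma indiscernible_same_sign m (b : nat -> 'I_m -> M) k (t : term 'I_m) a :
    indiscernible A b -> dcl_gen A a ->
  same_sign (teval (b 0%N) t - a) (teval (b k) t - a).
Proof.
move=> bA [n [n0 /gen_subgroupE[s as_]]].
have [p [par [u [parA su]]]] := term_finite_support s.
have key f := bA 1%N (fun=> 0%N) (fun=> k) _ _ p par parA f.
have {}key f : sat (join_env (fun ij : 'I_1 * 'I_m => b 0%N ij.2) par) f <->
    sat (join_env (fun ij : 'I_1 * 'I_m => b k ij.2) par) f.
  by apply: key => i j; rewrite !ord1.
pose tt : term ('I_1 * 'I_m + 'I_p) :=
  TAdd (tmuln (trename (fun i => inl (ord0, i)) t) n) (TOpp (trename inr u)).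
have ttE i : teval (join_env (fun ij : 'I_1 * 'I_m => b i ij.2) par) tt =
    (teval (b i) t - a) *+ n.
  by rewrite /= teval_muln !teval_rename mulrnBl as_ su.
apply/(@same_sign_mulrn _ _ _ _ n) => //.
pose E i := join_env (fun ij : 'I_1 * 'I_m => b i ij.2) par.
have h1 : 0 < teval (E 0%N) tt <-> 0 < teval (E k) tt := key (FLt (TZero _) tt).
have h2 : teval (E 0%N) tt < 0 <-> teval (E k) tt < 0 := key (FLt tt (TZero _)).
by rewrite !ttE in h1 h2.
Qed.

Lemma cuts_nonforking :
  cut_independent (dcl_gen A) (dcl_gen (A `|` C)) (dcl_gen (A `|` B)) ->
  forking_independent C B A.
Proof.
move=> ind [q [[n [r [rtp rq]]] [n' [s [sdiv qs]]]]].
pose b i := sval (cid (divides_witness (sdiv i))).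
pose js i := sval (cid (svalP (cid (divides_witness (sdiv i))))).
have bP i : [/\ b i 0%N = pf_par (s i), indiscernible A (b i) &
    forall c : C -> M, ~ forall k, k \in js i -> sat (join_env c (b i k)) (pf_form (s i))].
  exact: svalP (cid (svalP (cid (divides_witness (sdiv i))))).
(* The elements to be moved: the entries of the parameter tuples and of the members that witness the
   inconsistency. *)
pose ms := flatten [seq flatten [seq [seq b i k l | l <- enum 'I_(pf_arity (s i))]
                          | k <- 0%N :: js i] | i <- enum 'I_n'].
have msP i k l : k \in 0%N :: js i -> b i k l \in ms.
  move=> kj; apply/flattenP.
  exists (flatten [seq [seq b i k l | l <- enum 'I_(pf_arity (s i))] | k <- 0%N :: js i]).
    by apply/mapP; exists i; rewrite ?mem_enum.
  apply/flattenP; exists [seq b i k l | l <- enum 'I_(pf_arity (s i))].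
    by apply/mapP; exists k.
  by apply: map_f; rewrite mem_enum.
have AAB : dcl_gen A `<=` dspan (@set_val M (A `|` B)).
  by rewrite -dcl_genE; apply: dcl_gen_sub => x; left.
have ind0 := ind; rewrite [dcl_gen (A `|` B)]dcl_genE in ind0.
have agr0 : agree (@set_val M (A `|` B)) (@set_val M (A `|` B)) by move=> t; split.
(* Starting from the identity on A and B keeps these in place: [f] is the original position in [M],
   [f'] the new one in [N]. *)
have [N [j [W [f [f' [i0 [HN jP agr [fi f'i msf] indN]]]]]]] :=
  extend_env_seq HM ms HM agr0 (dcl_gen_divsub A) (dcl_gen_divsub (A `|` C)) AAB ind0.
have [rho rhoP] : exists rho : forall i, 'I_(pf_arity (r i)) -> W,
    forall i, f \o rho i = pf_par (r i) /\ f' \o rho i = j \o pf_par (r i).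
  suff h i : exists rho : 'I_(pf_arity (r i)) -> W,
      f \o rho = pf_par (r i) /\ f' \o rho = j \o pf_par (r i).
    by exists (fun i => sval (cid (h i))) => i; exact: svalP (cid (h i)).
  have [g gE] := choice (fun l => set_val_surj ((rtp i).1 l)).
  exists (i0 \o g); split; apply/funext => l /=; rewrite -gE; [exact: fi|exact: f'i].
have [om omP] : exists om : forall i, nat -> 'I_(pf_arity (s i)) -> W,
    forall i k, k \in 0%N :: js i -> f \o om i k = b i k.
  suff h i k : exists om : 'I_(pf_arity (s i)) -> W, k \in 0%N :: js i -> f \o om = b i k.
    by exists (fun i k => sval (cid (h i k))) => i k; exact: svalP (cid (h i k)).
  have [kj|kN] := boolP (k \in 0%N :: js i); last first.
    by have [g _] := choice (fun l => msf _ (@msP i 0%N l (mem_head _ _))); exists g.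
  have [g gE] := choice (fun l => msf _ (@msP i k l kj)).
  by exists g => _; apply/funext => l /=; rewrite gE.
(* C is embedded without being moved, so it still satisfies the formulas [r i], whose parameters are
   in A and B. *)
pose jc : C -> N := j \o set_val.
have jr i : sat (join_env jc (f' \o rho i)) (pf_form (r i)).
  have [_ ->] := rhoP i; have := (rtp i).2.
  rewrite /psat (agree_sat _ HM HN (emb_agree HM jP _)).
  by apply: (iffLR (sat_ext _ _)) => -[].
(* Otherwise [jc] satisfies every [r i] and no [s i]. Transferred to [M] and the original
   parameters, this contradicts the covering of [q]. *)
have [i si] : exists i, sat (join_env jc (f' \o om i 0%N)) (pf_form (s i)).
  apply: contrapT => ns.
  pose fs := [seq frename (join_rename (rho i)) (pf_form (r i)) | i <- enum 'I_n] ++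
    [seq FNot (frename (join_rename (om i 0%N)) (pf_form (s i))) | i <- enum 'I_n'].
  have [|x xP] := @sat_all_transfer M N C W fs f f' jc HM HN agr.
    move=> g gfs; case: (List.in_app_or _ _ _ gfs).
      by move=> /(@In_mapP _ _ _ _ _)[i _ <-]; apply/sat_join_rename; exact: jr.
    by move=> /(@In_mapP _ _ _ _ _)[i _ <-] h; apply: ns; exists i; apply/sat_join_rename.
  have /qs[i] : psat x q.
    apply: rq => i; rewrite /psat; have [<- _] := rhoP i; apply/sat_join_rename.
    apply: xP; apply/List.in_or_app; left.
    apply: (In_map (fun i => frename (join_rename (rho i)) (pf_form (r i)))).
    by apply/InE; rewrite mem_enum.
  have [b0 _ _] := bP i; rewrite /psat -b0 -(omP i 0%N) ?mem_head //.
  move=> si; suff /xP : List.In (FNot (frename (join_rename (om i 0%N)) (pf_form (s i)))) fs.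
    by apply; apply/sat_join_rename.
  apply/List.in_or_app; right.
  apply: (In_map (fun i => FNot (frename (join_rename (om i 0%N)) (pf_form (s i))))).
  by apply/InE; rewrite mem_enum.
have [_ bA incons] := bP i.
(* By indiscernibility the tuples at positions 0 and [k] have the same cuts over A; in the new
   position these determine the cuts over C. *)
have sk k : k \in js i -> sat (join_env jc (f' \o om i k)) (pf_form (s i)).
  move=> kj; move: si; apply: (iffLR (agree_sat _ HN HN _)) => t.
  have [u [v uv]] := tsplit_join t; rewrite !uv ![teval jc u + _]addrC -[teval jc u]opprK.
  apply: (cut_independent_same_sign HN indN).
  - rewrite (emb_teval jP) -(embN jP); apply: imageP.
    apply: (divsubN (dcl_gen_divsub _)); apply: (dcl_gen_sub (S := C)) => [y|]; first by right.
    by rewrite dcl_genE; exact: dspan_teval.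
  - by rewrite -(teval_rename (om i 0%N)); exact: dspan_teval.
  - by rewrite -(teval_rename (om i k)); exact: dspan_teval.
  move=> _ [a Aa <-].
  have fact k' : k' \in 0%N :: js i ->
      same_sign (teval (b i k') v - a) (teval (f' \o om i k') v - j a).
    move=> k'j; have [m [w [m0 aw]]] := AAB _ Aa.
    apply/(@same_sign_mulrn _ _ _ _ m) => //; rewrite !mulrnBl -(embMn jP) aw.
    have := agr (TAdd (tmuln (trename (om i k') v) m) (TOpp (trename i0 w))).
    rewrite /= !teval_muln !teval_rename (omP _ _ k'j).
    by rewrite (teval_ext w fi) (teval_ext w f'i) (emb_teval jP).
  apply: same_sign_trans (same_sign_sym (fact 0%N (mem_head _ _))) _.
  apply: same_sign_trans (indiscernible_same_sign k v bA Aa) _.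
  by apply: fact; rewrite inE kj orbT.
pose fs := [seq frename (join_rename (om i k)) (pf_form (s i)) | k <- js i].
have [|x xP] := @sat_all_transfer M N C W fs f f' jc HM HN agr.
  move=> g /(@In_mapP _ _ _ _ _)[k kj <-]; apply/sat_join_rename; apply: sk.
  exact/InE.
apply: (incons x) => k kj; rewrite -(omP i k) ?inE ?kj ?orbT //; apply/sat_join_rename/xP.
by apply: (In_map (fun k => frename (join_rename (om i k)) (pf_form (s i)))); apply/InE.
Qed.

End NonForking.

(** * Forking from a missing point *)

(** Comparison with an element of the divisible hull is multiplied out into a formula over [Z], so
    that saturation applies; finite satisfiability is [doag_between]. *)
Lemma saturated_cut (M : porderZmodType) (K Z X Y : set M) :
    is_DOAG M -> succ_saturated K -> Z #<= K ->
    X `<=` dcl_gen Z -> Y `<=` dcl_gen Z -> (forall x y, X x -> Y y -> x < y) ->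
  exists m, (forall x, X x -> x < m) /\ (forall y, Y y -> m < y).
Proof.
move=> HM Ksat ZK XZ YZ XY.
pose lower (q : pformula M unit) := exists x p (par : 'I_p -> M) s n,
  [/\ X x, forall i, Z (par i), (0 < n)%N /\ x *+ n = teval par s &
   q = PFormula (FLt (trename inr s) (tmuln (TVar (inl tt)) n)) par].
pose upper (q : pformula M unit) := exists y p (par : 'I_p -> M) s n,
  [/\ Y y, forall i, Z (par i), (0 < n)%N /\ y *+ n = teval par s &
   q = PFormula (FLt (tmuln (TVar (inl tt)) n) (trename inr s)) par].
have lowerE x p (par : 'I_p -> M) s n (c : unit -> M) : (0 < n)%N -> x *+ n = teval par s ->
    psat c (PFormula (FLt (trename inr s) (tmuln (TVar (inl tt)) n)) par) <-> x < c tt.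
  move=> n0 xs; rewrite /psat /= teval_rename teval_muln /= -[teval _ s]/(teval par s) -xs.
  exact: doag_ltrMn.
have upperE x p (par : 'I_p -> M) s n (c : unit -> M) : (0 < n)%N -> x *+ n = teval par s ->
    psat c (PFormula (FLt (tmuln (TVar (inl tt)) n) (trename inr s)) par) <-> c tt < x.
  move=> n0 xs; rewrite /psat /= teval_rename teval_muln /= -[teval _ s]/(teval par s) -xs.
  exact: doag_ltrMn.
have repr x : dcl_gen Z x -> exists p (par : 'I_p -> M) s n,
    (forall i, Z (par i)) /\ ((0 < n)%N /\ x *+ n = teval par s).
  rewrite dcl_genE => -[n [t [n0 xt]]].
  have [p [par [s [parZ ts]]]] := term_finite_support t.
  by exists p, par, s, n; rewrite -ts.
have [||c cP] := Ksat Z ZK [set q | lower q \/ upper q].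
- by move=> q [|] [x [p [par [s [n [_ h _ ->]]]]]].
- move=> n r rP.
  have /choice[f fP] : forall i, exists z : M * bool,
      if z.2 then X z.1 /\ (forall c : unit -> M, z.1 < c tt -> psat c (r i))
      else Y z.1 /\ (forall c : unit -> M, c tt < z.1 -> psat c (r i)).
    move=> i; have [[x [p [par [s [k [Xx _ [k0 xs] ->]]]]]]|] := rP i.
      by exists (x, true); split=> // c; rewrite (lowerE x).
    by move=> [x [p [par [s [k [Xx _ [k0 xs] ->]]]]]]; exists (x, false); split=> // c; rewrite (upperE x).
  have [|m [m1 m2]] := @doag_between _ HM [seq (f i).1 | i <- enum 'I_n & (f i).2]
                           [seq (f i).1 | i <- enum 'I_n & ~~ (f i).2].
    move=> x y /mapP[i + ->] /mapP[j + ->]; rewrite !mem_filter => /andP[fi _] /andP[/negbTE fj _].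
    by have := fP i; have := fP j; rewrite fi fj => -[Yy _] [Xx _]; exact: XY.
  exists (fun=> m) => i; have := fP i; case: ifP => fi [_]; apply.
    by apply: m1; apply: map_f; rewrite mem_filter fi mem_enum.
  by apply: m2; apply: map_f; rewrite mem_filter fi mem_enum.
exists (c tt); split=> [x Xx|y Yy].
  have [p [par [s [n [parZ [n0 xs]]]]]] := repr _ (XZ _ Xx).
  by apply/(lowerE x _ par s n) => //; apply: cP; left; exists x, p, par, s, n.
have [p [par [s [n [parZ [n0 xs]]]]]] := repr _ (YZ _ Yy).
by apply/(upperE y _ par s n) => //; apply: cP; right; exists y, p, par, s, n.
Qed.

(** [x] may have either sign, and the case [k = 0] forces [0 < y]. *)
Definition infsmall (M : porderZmodType) (x y : M) : Prop :=
  forall k, x *+ k < y /\ - x *+ k < y.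

(** * Infinitesimals and towers of widely separated elements *)

Section Infsmall.
Variables (M : porderZmodType) (HM : is_DOAG M).
Implicit Types x y z : M.

Lemma infsmall_gt0 x y : infsmall x y -> 0 < y.
Proof. by move=> /(_ 0)[]; rewrite mulr0n. Qed.

Lemma infsmall0 y : 0 < y -> infsmall 0 y.
Proof. by move=> y0 k; rewrite oppr0 mul0rn. Qed.

Lemma infsmallN x y : infsmall x y -> infsmall (- x) y.
Proof. by move=> xy k; have [h1 h2] := xy k; rewrite opprK. Qed.

Lemma infsmallD x y z : infsmall x z -> infsmall y z -> infsmall (x + y) z.
Proof.
move=> xz yz k; have [h1 h2] := xz (k * 2)%N; have [h3 h4] := yz (k * 2)%N.
move: h1 h2 h3 h4; rewrite !mulrnA opprD !mulrnDl !mulNrn => h1 h2 h3 h4; split; dlra HM.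
Qed.

Lemma infsmallMz x y k : infsmall x y -> infsmall (x *~ k) y.
Proof.
have nat_case n : infsmall x y -> infsmall (x *+ n) y.
  by move=> xy k'; have := xy (n * k')%N; rewrite !mulrnA mulNrn.
case: k => n xy; [exact: nat_case|exact/infsmallN/nat_case].
Qed.

Lemma infsmall_lt x y : infsmall x y -> x < y /\ - x < y.
Proof. by move/(_ 1). Qed.

Lemma infsmall_pos x y : 0 < x -> (forall k, x *+ k < y) -> infsmall x y.
Proof.
move=> x0 h k; split; first exact: h.
have := h 0; rewrite mulr0n mulNrn; case: k => [|k] y0; first by rewrite mulr0n oppr0.
by have := doag_mulrn_gt0 HM k x0; dlra HM.
Qed.

Lemma infsmall_trans x y z : infsmall x y -> infsmall y z -> infsmall x z.
Proof.
move=> xy yz k; have [h1 h2] := xy k; have [h3 h4] := infsmall_lt yz.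
by split; dlra HM.
Qed.

Lemma infsmall_sum y (v : nat -> M) (n : nat -> int) k :
  0 < y -> (forall p, (p < k)%N -> infsmall (v p) y) ->
  infsmall (\sum_(p < k) v p *~ n p) y.
Proof.
move=> y0; elim: k => [|k IH] h; first by rewrite big_ord0; exact: infsmall0.
rewrite big_ord_recr /=; apply: infsmallD; last exact/infsmallMz/h.
by apply: IH => p pk; apply: h; exact: ltnW.
Qed.

Lemma infsmall_same_sign x x' y y' k : infsmall x y -> infsmall x' y' -> k != 0 ->
  same_sign (y *~ k + x) (y' *~ k + x').
Proof.
have pos n : infsmall x y -> infsmall x' y' ->
    0 < y *+ n.+1 + x /\ 0 < y' *+ n.+1 + x'.
  have aux z w : infsmall z w -> 0 < w *+ n.+1 + z.
    move=> zw; have w0 := infsmall_gt0 zw; have [_ h] := infsmall_lt zw.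
    by move/ltW/(doag_mulrn_ge0 HM n): (w0); rewrite mulrS; dlra HM.
  by move=> /aux h1 /aux h2.
have gt z : 0 < z -> ~ z < 0 by move=> h1 h2; have := lt_trans h1 h2; rewrite ltxx.
case: k => [[//|n]|n] h h' _.
  by have [p p'] := pos n h h'; split; split=> // /gt.
suff aux (z w : M) : infsmall z w -> w *~ Negz n + z < 0.
  have := aux _ _ h; have := aux _ _ h'; move: (_ + _) (_ + _) => z w z0 w0.
  by split; split=> // h0; have := gt _ h0.
move=> zw; have := infsmallN zw => zw'; have w0 := infsmall_gt0 zw'.
have [h1 h2] := infsmall_lt zw'.
have -> : w *~ Negz n = - (w *+ n.+1) by [].
by move/ltW/(doag_mulrn_ge0 HM n): (w0); rewrite mulrS; dlra HM.
Qed.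

(* The sign of a combination of widely separated elements is the sign of the
   coefficient of its largest term. *)
Lemma tower_same_sign (v v' : nat -> M) (n : nat -> int) x k :
    (forall p, infsmall (v p) (v p.+1)) -> (forall p, infsmall (v' p) (v' p.+1)) ->
    infsmall x (v 0%N) -> infsmall x (v' 0%N) ->
  same_sign (\sum_(p < k) v p *~ n p + x) (\sum_(p < k) v' p *~ n p + x).
Proof.
move=> vv vv' xv xv'.
have small (w : nat -> M) m : (forall p, infsmall (w p) (w p.+1)) -> infsmall x (w 0%N) ->
    infsmall (\sum_(p < m) w p *~ n p + x) (w m).
  move=> ww xw; have wlt p q : (p < q)%N -> infsmall (w p) (w q).
    elim: q => // q IH; rewrite ltnS leq_eqVlt => /orP[/eqP->|/IH h]; first exact: ww.
    exact: infsmall_trans (ww q).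
  apply: infsmallD.
    apply: infsmall_sum => [|p]; last exact: wlt.
    by case: m => [|m]; [exact: infsmall_gt0 xw|exact: infsmall_gt0 (ww m)].
  by case: m => // m; apply: infsmall_trans xw (wlt _ _ _).
elim: k => [|k IH]; first by rewrite !big_ord0.
have [n0|n0] := eqVneq (n k) 0; first by rewrite !big_ord_recr /= n0 !mulr0z !addr0.
rewrite !big_ord_recr /= -!addrA ![_ *~ n k + x]addrC !addrA.
rewrite ![_ + _ *~ n k]addrC; apply: infsmall_same_sign => //; exact: small.
Qed.

End Infsmall.

Lemma term_nat_linear (t : term nat) : exists (n : nat -> int) (p0 : nat),
  forall p, (p0 <= p)%N -> forall (M : porderZmodType) (w : nat -> M),
  teval w t = \sum_(i < p) w i *~ n i.
Proof.
elim: t => [v||t [n [p0 h]] u [n' [p0' h']]|t [n [p0 h]]].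
- exists (fun i => (i == v)%:Z), v.+1 => p vp M w.
  rewrite (bigD1 (Ordinal vp)) //= eqxx mulr1z big1 ?addr0 // => i.
  by rewrite -val_eqE /= => /negbTE ->; rewrite mulr0z.
- by exists (fun=> 0), 0 => p _ M w; rewrite big1 // => i _; rewrite mulr0z.
- exists (fun i => n i + n' i), (maxn p0 p0') => p; rewrite geq_max => /andP[h1 h2] M w.
  rewrite /= (h p) // (h' p) // -big_split /=.
  by apply: eq_bigr => i _; rewrite mulrzDr.
- exists (fun i => - n i), p0 => p p0p M w; rewrite /= (h p) // -sumrN.
  by apply: eq_bigr => i _; rewrite mulrNz.
Qed.

Lemma extend_increasing k (s : 'I_k -> nat) : {homo s : i j / (i < j)%N} ->
  exists2 s' : nat -> nat, {homo s' : i j / (i < j)%N} & forall i : 'I_k, s' i = s i.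
Proof.
(* The sum of all values dominates each of them, and the index added to it keeps the extension
   strictly increasing. *)
move=> sP; exists (fun i => if insub i is Some o then s o else (\sum_(o < k) s o + i)%N).
  move=> i j ij; case: insubP => [o ok oi|ik]; case: insubP => [o' o'k o'j|jk] //=.
  - by apply: sP; rewrite oi o'j.
  - apply: (@leq_ltn_trans (\sum_(o < k) s o)%N).
      by rewrite (bigD1 o) //= leq_addr.
    rewrite -[X in (X < _)%N]addn0 ltn_add2l; exact: leq_ltn_trans ij.
  - by case/negP: ik; exact: ltn_trans ij o'k.
  - by rewrite ltn_add2l.
by move=> i; rewrite valK.
Qed.

(** A term in members of the sequence and elements of A is a combination of tower elements plus some
    x = N e + a. If [x] is large its sign decides; if it is infinitesimal, the leading tower
    coefficient does, or [x] when there is none. Neither depends on the choice of increasing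
    indices. *)
Lemma tower_indiscernible (M : porderZmodType) (A : set M) (e : M) (s : nat -> M) :
    is_DOAG M -> (forall n, infsmall (s n) (s n.+1)) ->
    (forall (N : nat) a, dcl_gen A a ->
       [\/ infsmall (e *+ N + a) (s 0%N), forall n, infsmall (s n) (e *+ N + a)
         | forall n, infsmall (s n) (- (e *+ N + a))]) ->
  indiscernible A (fun n (j : 'I_2) => e + s (n.*2 + j)%N).
Proof.
move=> HM ss H k si ti siP tiP l a aA f.
have {}H (N : int) b : dcl_gen A b ->
    [\/ infsmall (e *~ N + b) (s 0%N), forall n, infsmall (s n) (e *~ N + b)
         | forall n, infsmall (s n) (- (e *~ N + b))].
  move=> Ab; case: N => N; first exact: H.
  have -> : e *~ Negz N + b = - (e *+ N.+1 + - b) by rewrite opprD opprK.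
  case: (H N.+1 (- b)) => [|h|h|h]; first exact: (divsubN (dcl_gen_divsub _)).
  - by constructor 1; exact: infsmallN.
  - by constructor 3; rewrite opprK.
  - by constructor 2.
have slt p q : (p < q)%N -> infsmall (s p) (s q).
  elim: q => // q IH; rewrite ltnS leq_eqVlt => /orP[/eqP->|/IH h]; first exact: ss.
  exact: infsmall_trans (ss q).
apply: agree_sat => // t; have [r [u tE]] := tsplit_join t; rewrite !tE.
(* A pair of indices is flattened to 2i + j; [w] recovers the pair by halving and parity and selects
   the positions by [sg]. *)
pose h (ij : 'I_k * 'I_2) : nat := (ij.1.*2 + ij.2)%N.
have [n [p0 /(_ p0 (leqnn _)) nE]] := term_nat_linear (trename h r).
pose w (sg : nat -> nat) p := s ((sg p./2).*2 + odd p)%N.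
have hE (ij : 'I_k * 'I_2) : (h ij)./2 = ij.1 /\ odd (h ij) = ij.2 :> nat.
  rewrite /h; case: ij => i j /=; rewrite oddD odd_double /= halfD odd_double doubleK /=.
  by case: j => -[|[|]] // ? /=; rewrite addn0.
have wE sg (sg' : nat -> nat) : (forall i : 'I_k, sg' i = sg i) ->
    teval (fun ij : 'I_k * 'I_2 => e + s ((sg ij.1).*2 + ij.2)%N) r + teval a u =
    \sum_(i < p0) w sg' i *~ n i + (e *~ (\sum_(i < p0) n i) + teval a u).
  move=> sgE; rewrite addrA; congr (_ + _).
  transitivity (teval (fun p => e + w sg' p) (trename h r)).
    rewrite teval_rename; apply: teval_ext => ij /=; rewrite /w.
    by have [-> ->] := hE ij; rewrite sgE.
  rewrite nE mulrz_sumr addrC -big_split /=; apply: eq_bigr => i _.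
  by rewrite mulrzDl.
have [si' si'P si'E] := extend_increasing siP; have [ti' ti'P ti'E] := extend_increasing tiP.
rewrite (wE _ _ si'E) (wE _ _ ti'E).
have wP (sg : nat -> nat) : {homo sg : i j / (i < j)%N} -> forall p, infsmall (w sg p) (w sg p.+1).
  move=> sgP p; apply: slt; rewrite /= uphalf_half; case: (odd p) => /=.
    by rewrite addn0 addn1 add1n -[in X in (X <= _)%N]doubleS leq_double; exact: sgP.
  by rewrite addn0 add0n addn1.
have w0 sg p : infsmall p (s 0%N) -> infsmall p (w sg 0%N).
  move=> ps; rewrite /w; move: (_ + _)%N => q; case: q => // q.
  by apply: infsmall_trans ps (slt _ _ _).
have Ab : dcl_gen A (teval a u).
  elim: (u) => [i||u1 IH u2 IH'|u1 IH] /=.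
  - have [y <-] := set_val_surj (aA i); rewrite dcl_genE; exact: (dspan_teval _ (TVar y)).
  - exact: divsub0 (dcl_gen_divsub _).
  - exact: divsubD (dcl_gen_divsub _) _ _ IH IH'.
  - exact: divsubN (dcl_gen_divsub _) _ IH.
case: (H (\sum_(i < p0) n i) _ Ab); move: (_ + teval a u) => x Hx.
- by apply: tower_same_sign => //; [exact: wP|exact: wP|exact: w0|exact: w0].
- have big sg : 0 < \sum_(i < p0) w sg i *~ n i + x.
    have [] := infsmall_lt (@infsmall_sum _ HM x (w sg) n p0 (infsmall_gt0 (Hx 0%N)) (fun p _ => Hx _)).
    by dlra HM.
  by have := big si'; have := big ti'; split; split=> //; dlra HM.
- have big sg : \sum_(i < p0) w sg i *~ n i + x < 0.
    have [] := infsmall_lt (@infsmall_sum _ HM (- x) (w sg) n p0 (infsmall_gt0 (Hx 0%N)) (fun p _ => Hx _)).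
    by dlra HM.
  by have := big si'; have := big ti'; split; split=> //; dlra HM.
Qed.

(** * Dividing formulas built from towers *)

Section Forking.
Variables (M : porderZmodType) (A B C : set M).
Hypotheses (HM : is_DOAG M) (Msat : succ_saturated (A `|` B `|` C)).

Lemma dcl_gen_formula (S : set M) x : dcl_gen S x ->
  exists p (par : 'I_p -> M) (s : term 'I_p) n,
    (forall i, S (par i)) /\ ((0 < n)%N /\ x *+ n = teval par s).
Proof.
rewrite dcl_genE => -[n [t [n0 xt]]].
have [p [par [s [parS ts]]]] := term_finite_support t.
by exists p, par, s, n; rewrite -ts.
Qed.

(** As [b1, b2] is enclosed in [u_0, u_1], with u_n = e + s_n, the type implies that [t] lies in the
    latter. This formula divides, since already [u_2, u_3] is disjoint from [u_0, u_1]. *)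
Lemma forks_of_tower (t : term C) b1 b2 e (s : nat -> M) :
    dcl_gen (A `|` B) b1 -> dcl_gen (A `|` B) b2 ->
    b1 <= teval set_val t -> teval set_val t <= b2 ->
    e + s 0%N <= b1 -> b2 <= e + s 1%N ->
    (forall n, infsmall (s n) (s n.+1)) ->
    (forall (N : nat) a, dcl_gen A a ->
       [\/ infsmall (e *+ N + a) (s 0%N), forall n, infsmall (s n) (e *+ N + a)
         | forall n, infsmall (s n) (- (e *+ N + a))]) ->
  type_forks A (tp (@set_val M C) (A `|` B)).
Proof.
move=> Bb1 Bb2 le1 le2 u0 u1 ss Hs.
pose b n (j : 'I_2) := e + s (n.*2 + j)%N.
have bA : indiscernible A b by exact: tower_indiscernible.
pose T : term (C + 'I_2) := trename inl t.
pose F := FAnd (FNot (FLt T (TVar (inr ord0)))) (FNot (FLt (TVar (inr ord_max)) T)).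
pose q := PFormula F (b 0%N).
have FE n (c : C -> M) : psat c (PFormula F (b n)) <->
    b n ord0 <= teval c t /\ teval c t <= b n ord_max.
  rewrite /psat /= teval_rename -!(doag_ltNge HM).
  by rewrite (teval_ext t (_ : join_env c (b n) \o inl =1 c)).
exists q; split; last first.
  exists 1, (fun=> q); split=> [_|c qc]; last by exists ord0.
  exists b; split=> // /(_ 2 (fun i => PFormula F (b i)))[i|c cP]; first by exists (i : nat).
  have /FE[_ h1] := cP ord0; have /FE[h2 _] := cP ord_max.
  have : b 0%N ord_max < b 1%N ord0.
    have [h _] := infsmall_lt (ss 1%N).
    by rewrite /b /= [e + _]addrC [e + s (_ + _)%N]addrC; apply: doag_ltD.
  by move: h1 h2 => /=; dlra HM.
have [p1 [par1 [s1 [n1 [parB1 [n10 b1E]]]]]] := dcl_gen_formula Bb1.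
have [p2 [par2 [s2 [n2 [parB2 [n20 b2E]]]]]] := dcl_gen_formula Bb2.
pose r1 : pformula M C := PFormula (FNot (FLt (tmuln (trename inl t) n1) (trename inr s1))) par1.
pose r2 : pformula M C := PFormula (FNot (FLt (trename inr s2) (tmuln (trename inl t) n2))) par2.
have r1E c : psat c r1 <-> b1 <= teval c t.
  rewrite /psat /= teval_muln !teval_rename (doag_ltNge HM) -(doag_lerMn HM b1 (teval c t) n10) b1E.
  by rewrite (teval_ext t (_ : join_env c par1 \o inl =1 c)) // (teval_ext s1 (_ : join_env c par1 \o inr =1 par1)).
have r2E c : psat c r2 <-> teval c t <= b2.
  rewrite /psat /= teval_muln !teval_rename (doag_ltNge HM) -(doag_lerMn HM (teval c t) b2 n20) b2E.
  by rewrite (teval_ext t (_ : join_env c par2 \o inl =1 c)) // (teval_ext s2 (_ : join_env c par2 \o inr =1 par2)).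
exists 2, (fun i => if i == ord0 then r1 else r2); split=> [i|c cP].
  by case: ifP => _; split=> //; [apply/r1E|apply/r2E].
have /r1E h1 := cP ord0; have /r2E h2 := cP ord_max.
by apply/FE; rewrite /b /=; split; dlra HM.
Qed.

Let D := dcl_gen A.
Let DP : divsub D := dcl_gen_divsub A.

Variables b1 b2 : M.
Hypotheses (Bb1 : dcl_gen (A `|` B) b1) (Bb2 : dcl_gen (A `|` B) b2).
Hypothesis b12 : b1 <= b2.
Hypothesis noD : forall a, D a -> b1 <= a -> a <= b2 -> False.

Lemma realize_AB (X Y : set M) :
    X `<=` dcl_gen (A `|` B) -> Y `<=` dcl_gen (A `|` B) ->
    (forall x y, X x -> Y y -> x < y) ->
  exists m, (forall x, X x -> x < m) /\ (forall y, Y y -> m < y).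
Proof. by apply: (saturated_cut HM Msat); apply: subset_card_le => x; left. Qed.

(* As b1 is not in dcl A, some element of B is not in A, which leaves room for
   one additional parameter even when A, B and C are finite. *)
Lemma realize_A1 (z : M) (X Y : set M) :
    X `<=` dcl_gen (A `|` [set z]) -> Y `<=` dcl_gen (A `|` [set z]) ->
    (forall x y, X x -> Y y -> x < y) ->
  exists m, (forall x, X x -> x < m) /\ (forall y, Y y -> m < y).
Proof.
apply: (saturated_cut HM Msat).
have [b [Bb nAb]] : exists b, B b /\ ~ A b.
  apply: contrapT => nb; apply: (noD (a := b1)) => //.
  by apply: dcl_gen_sub Bb1 => x [//|Bx]; apply: contrapT => nAx; apply: nb; exists x.
apply: (@card_le_trans _ _ _ (A `|` [set b])); last first.
  by apply: subset_card_le => x [Ax|->]; left; [left|right].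
have -> : A `|` [set z] = (fun x => if x == b then z else x) @` (A `|` [set b]).
  apply/seteqP; split=> [x [Ax|->]|_ [x [Ax|->] <-]].
  - exists x; first by left.
    by case: eqVneq => // xb; rewrite xb in Ax.
  - by exists b; [right|rewrite eqxx].
  - by left; case: eqVneq => // xb; rewrite xb in Ax.
  - by right; rewrite eqxx.
exact: card_image_le.
Qed.

Definition below_all (Y : set M) (s : M) := 0 < s /\ forall y k, Y y -> s *+ k < y.

Lemma below_all_of_div (Y : set M) s : 0 < s ->
    (forall y n, Y y -> exists2 z, Y z & z *+ n.+1 = y) ->
    (forall y, Y y -> s < y) -> below_all Y s.
Proof.
move=> s0 Ydiv sY; split=> // y [|n] Yy; first by rewrite mulr0n; apply: lt_trans (sY _ Yy).
have [z Yz <-] := Ydiv y n Yy; apply/(doag_ltrMn HM) => //; exact: sY.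
Qed.

(** Each element is realized over A and its predecessor alone, the one additional parameter that
    [realize_A1] allows: it has to lie above the multiples of the predecessor and below [Y]. *)
Lemma tower_exists (Y : set M) (s0 : M) :
    Y `<=` D -> (forall y n, Y y -> exists2 z, Y z & z *+ n.+1 = y) -> below_all Y s0 ->
  exists s : nat -> M, [/\ s 0%N = s0, forall n, below_all Y (s n)
    & forall n, infsmall (s n) (s n.+1)].
Proof.
move=> YD Ydiv Ys0.
have next (x : {s | below_all Y s}) : exists y : {s | below_all Y s}, infsmall (sval x) (sval y).
  case: x => x xY; case: (xY) => x0 xlt.
  have [|||m [m1 m2]] := @realize_A1 x [set z | exists k, z = x *+ k] Y.
  - move=> _ [k ->]; apply: (divsubMn (dcl_gen_divsub _)); rewrite dcl_genE.
    have [v vx] := @set_val_surj _ (A `|` [set x]) x (or_intror erefl).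
    by rewrite -[X in dspan _ X]vx; exact: (dspan_teval _ (TVar v)).
  - by move=> y /YD; apply: dcl_gen_sub => z; left.
  - by move=> _ y [k ->]; exact: xlt.
  have mY : below_all Y m.
    apply: below_all_of_div => //; apply: (lt_trans x0).
    by apply: m1; exists 1; rewrite mulr1n.
  exists (exist _ m mY); apply: infsmall_pos => //= k; apply: m1.
  by exists k.
have [f fP] := choice next.
pose s n := sval (iter n f (exist _ s0 Ys0)).
exists s; split=> // n; first exact: svalP.
exact: fP.
Qed.

(* The archimedean class of g has no representative in D. *)
Definition new_class (g : M) := forall n a, D a -> a <= g *+ n -> g <= a *+ n -> False.

(** Here e = a, and the tower starts at b1 - a and continues beyond b2 - a. The class being new,
    every element of D is either infinitesimal with respect to b1 - a or, up to sign, above the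
    whole tower. *)
Lemma forks_of_new_class (t : term C) a :
    b1 <= teval set_val t -> teval set_val t <= b2 ->
    D a -> a < b1 -> new_class (b1 - a) ->
  type_forks A (tp (@set_val M C) (A `|` B)).
Proof.
move=> le1 le2 Da ab1 new; set j := b1 - a in new.
have j0 : 0 < j by rewrite /j; dlra HM.
have upn n (x : M) : 0 < x -> x <= x *+ n.+1.
  by move=> x0; have := doag_mulrn_ge0 HM n (ltW x0); rewrite mulrS; dlra HM.
have above y : D y -> j < y -> forall k, j *+ k < y.
  move=> Dy jy [|k]; first by rewrite mulr0n; dlra HM.
  apply/(doag_leNgt HM) => h; apply: (new k.+1 y) => //.
  have y0 : 0 < y by dlra HM.
  by have := upn k y y0; dlra HM.
have below y : D y -> y <= j -> forall k, y *+ k < j.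
  move=> Dy yj [|k]; first by rewrite mulr0n.
  apply/(doag_leNgt HM) => h; apply: (new k.+1 y) => //.
  by have := upn k j j0; dlra HM.
pose Y := [set y | D y /\ j < y].
have Ydiv y n : Y y -> exists2 z, Y z & z *+ n.+1 = y.
  move=> [Dy jy]; have [z Dz zE] := divsub_div HM DP (ltn0Sn n) Dy; exists z => //; split=> //.
  by apply/(doag_ltrMn HM _ _ (ltn0Sn n)); rewrite zE; exact: above.
(* An element [y] of D with j < y <= b2 - a would put a + y in [b1, b2]. *)
have [|s [s0 sY ss]] := tower_exists (Y := Y) (s0 := b2 - a) (fun y => @proj1 _ _) Ydiv.
  apply: below_all_of_div => // [|y [Dy jy]]; first by dlra HM.
  apply/(doag_leNgt HM) => h; apply: (noD (a := a + y)); first exact: divsubD.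
    by rewrite /j in jy; dlra HM.
  by dlra HM.
(* With [j] as first term, e + v_0 is b1 itself, while e + v_1 remains above b2. *)
pose v n := if n is n'.+1 then s n'.+1 else j.
have vY n : below_all Y (v n).
  case: n => [|n]; [split=> //= y k [Dy jy]; exact: above|exact: sY].
apply: (forks_of_tower (t := t) (e := a) (s := v) Bb1 Bb2 le1 le2).
- by rewrite /v /j; dlra HM.
- by rewrite /v; have [h _] := infsmall_lt (ss 0%N); rewrite s0 in h; dlra HM.
- case=> [|n]; last exact: ss.
  apply: infsmall_pos => // k; have [h _] := ss 0%N k; apply: le_lt_trans h.
  case: k => [|k]; first by rewrite !mulr0n.
  by apply/(doag_lerMn HM) => //; rewrite s0 /v /j; dlra HM.
move=> N x Dx; have Dy : D (a *+ N + x) by apply: divsubD => //; exact: divsubMn.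
move: (_ + x) Dy => {Dx}x Dx.
have large z : D z -> j < z -> forall n, infsmall (v n) z.
  by move=> Dz jz n; have [v0 vlt] := vY n; apply: infsmall_pos => // k; apply: vlt.
have [h|/(doag_ltNge HM) h] := pselect (j < x); first by constructor 2; exact: large.
have [h'|/(doag_ltNge HM) h'] := pselect (j < - x).
  by constructor 3; apply: large => //; exact: divsubN.
by constructor 1 => k; split; apply: below => //; exact: divsubN.
Qed.

Definition distance a g := (a < b1 /\ g = b1 - a) \/ (b2 < a /\ g = a - b2).

(** A tower is placed below [P], above [W] and above the multiples of b2 - b1. With e = b1 - s_1,
    the point [e] fills the cut of the interval over D: its distance from an element of D is at
    least that of the interval, up to s_1, hence beyond the whole tower. *)
Lemma forks_of_old_classes (t : term C) :
    b1 <= teval set_val t -> teval set_val t <= b2 ->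
    (forall a g, D a -> distance a g -> exists n a', [/\ D a', a' <= g *+ n & g <= a' *+ n]) ->
  type_forks A (tp (@set_val M C) (A `|` B)).
Proof.
move=> le1 le2 old.
have distP a : D a -> exists2 g, distance a g & 0 < g.
  move=> Da; case: (doag_ltgt HM a b1) => [h|h|h].
  - by exists (b1 - a); [left|dlra HM].
  - by exfalso; apply: (noD Da); rewrite h.
  case: (doag_ltgt HM a b2) => [h'|h'|h'].
  - by exfalso; apply: (noD Da); exact: ltW.
  - by exfalso; apply: (noD Da); rewrite ?h' // -h'; exact: ltW.
  - by exists (a - b2); [right|dlra HM].
have dist0 a g : D a -> distance a g -> 0 < g.
  by move=> Da [[h ->]|[h ->]]; dlra HM.
pose P := [set y | D y /\ exists a g n, [/\ D a, distance a g & g <= y *+ n]].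
pose W := [set w | D w /\ forall a g n, D a -> distance a g -> w *+ n < g].
have PW y : D y -> P y \/ W y.
  move=> Dy; have [?|nP] := pselect (P y); [by left|right].
  split=> // a g n Da ag; apply/(doag_leNgt HM) => h; apply: nP; split=> //.
  by exists a, g, n.
have Pdiv y n : P y -> exists2 z, P z & z *+ n.+1 = y.
  move=> [Dy [a [g [k [Da ag gy]]]]].
  have [z Dz zE] := divsub_div HM DP (ltn0Sn n) Dy; exists z => //; split=> //.
  by exists a, g, (n.+1 * k)%N; rewrite mulrnA zE.
have [|||m [m1 m2]] := @realize_AB ([set x | exists k, x = (b2 - b1) *+ k] `|` W) P.
- move=> x [[k ->]|[Dx _]]; first exact: (divsubMn (dcl_gen_divsub _) _ (divsubB (dcl_gen_divsub _) Bb2 Bb1)).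
  by apply: dcl_gen_sub Dx => z; left.
- by move=> y [Dy _]; apply: dcl_gen_sub Dy => z; left.
- move=> x y [[k ->]|[Dx xW]] [Dy [a [g [n [Da ag gy]]]]]; apply/(doag_leNgt HM) => yx.
    have g0 := dist0 _ _ Da ag; have [m [a' [Da' a'g ga']]] := old _ _ Da ag.
    set d := b2 - b1 in yx.
    have gd : g <= d *+ (k * n).
      apply: le_trans gy _; case: n => [|n]; first by rewrite muln0 !mulr0n.
      by rewrite mulrnA; apply/(doag_lerMn HM).
    have m0 : (0 < m)%N by case: m ga' {a'g} => // ; rewrite mulr0n => h; exfalso; dlra HM.
    have K0 : (0 < k * n)%N.
      by case: (k * n)%N gd => // ; rewrite mulr0n => h; exfalso; dlra HM.
    have mK0 : (0 < m * (k * n))%N by rewrite muln_gt0 m0.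
    (* If an element of [P] were at most a multiple of [d], so would be the distance [g]. Its class
       is represented by [a'], and a fraction [h] of [a'] is a step in D no longer than the
       interval. *)
    have [h Dh hE] := divsub_div HM DP mK0 Da'.
    have hd : h <= d.
      apply/(doag_lerMn HM _ _ K0); apply: le_trans gd.
      by apply/(doag_lerMn HM _ _ m0); rewrite -mulrnA mulnC hE.
    have ex : exists p, g <= h *+ p by exists (m * (k * n) * m)%N; rewrite mulrnA hE.
    (* The first multiple of [h] to reach [g] exceeds it by at most [d], so moving that far from [a]
       ends in the interval. *)
    case: (ex_minnP ex) => p gp pmin.
    have pd : h *+ p <= g + d.
      case: p gp pmin => [|p] gp pmin; first by move: gp; rewrite mulr0n => gp; exfalso; dlra HM.
      have hg : h *+ p < g by apply/(doag_leNgt HM) => /pmin; rewrite ltnn.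
      by rewrite mulrS; dlra HM.
    have Dhp : D (h *+ p) by exact: divsubMn.
    case: ag => -[ab gE]; rewrite /d gE in pd gp.
      by apply: (noD (a := a + h *+ p)); [exact: divsubD|dlra HM|dlra HM].
    by apply: (noD (a := a - h *+ p)); [exact: divsubB|dlra HM|dlra HM].
  have := xW a g n Da ag; move: gy; case: n => [|n] gy.
    by have := dist0 _ _ Da ag; rewrite mulr0n in gy; dlra HM.
  by move/(doag_lerMn HM _ _ (ltn0Sn n)): yx; dlra HM.
have m0 : 0 < m by apply: m1; left; exists 0; rewrite mulr0n.
have dm : b2 - b1 < m by apply: m1; left; exists 1; rewrite mulr1n.
have [s [s0 sP ss]] := tower_exists (fun y => @proj1 _ _) Pdiv (below_all_of_div m0 Pdiv m2).
(* s_1 is left out, being used in [e]: thus v_0 = s_0 < s_1 gives e + v_0 < b1, and v_1 = s_2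
   exceeds s_1 + (b2 - b1). *)
pose v n := if n is n'.+1 then s n'.+2 else s 0%N.
have slt p q : (p < q)%N -> infsmall (s p) (s q).
  elim: q => // q IH; rewrite ltnS leq_eqVlt => /orP[/eqP->|/IH h]; first exact: ss.
  exact: infsmall_trans (ss q).
have [s01 _] := infsmall_lt (ss 0%N).
apply: (forks_of_tower (t := t) (e := b1 - s 1%N) (s := v) Bb1 Bb2 le1 le2).
- by rewrite /v; dlra HM.
- rewrite /v /=; have [h _] := ss 1%N 2%N; rewrite s0 in s01; dlra HM.
- by case=> [|n]; exact: slt.
(* Some tower element beyond v_n and s_1 has all its multiples below [g], so subtracting s_1 leaves
   [g] infinitely larger than v_n. *)
have large n g : 0 < g -> (exists2 y, P y & y <= g) -> infsmall (v n) (g - s 1%N).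
  move=> g0 [y Py yg]; have vs : v n < s n.+2 by case: (n) => [|n'] /=; [have [] := infsmall_lt (slt 0%N 2%N isT)|have [] := infsmall_lt (ss n'.+2)].
  have v0 : 0 < v n by case: (n) => [|n'] /=; [exact: (sP 0%N).1|exact: (sP n'.+2).1].
  apply: infsmall_pos => // k.
  have [_ /(_ y k.+1 Py)] := sP n.+2; rewrite mulrS.
  have [h _] := infsmall_lt (slt 1%N n.+2 isT).
  have : v n *+ k <= s n.+2 *+ k.
    by case: k => [|k]; [rewrite !mulr0n|apply/(doag_lerMn HM) => //; exact: ltW].
  by dlra HM.
(* For coefficient 0, either a or -a is in [P], above the tower, or both are in [W], whose multiples
   stay below s_0. *)
move=> [|N] a Da.
  rewrite mulr0n add0r; have [aP|aW] := PW _ Da.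
    constructor 2 => n; have [v0 vlt] : below_all P (v n) by case: (n) => [|n']; exact: sP.
    by apply: infsmall_pos => // k; exact: vlt.
  have [aP|naW] := PW _ (divsubN DP Da).
    constructor 3 => n; have [v0 vlt] : below_all P (v n) by case: (n) => [|n']; exact: sP.
    by apply: infsmall_pos => // k; exact: vlt.
  have Wn w k : W w -> w *+ k < m.
    move=> [Dw wW]; apply: m1; right; split; first exact: divsubMn.
    by move=> a0 g n Da0 ag; rewrite -mulrnA; exact: (wW _ _ (k * n)%N Da0 ag).
  by constructor 1 => k; rewrite /v s0; split; [exact: (Wn _ k aW)|exact: (Wn _ k naW)].
(* For a positive coefficient the element is a multiple of e - a0 with a0 in D, and the distance
   from a0 to the interval controls its size. *)
have [a0 Da0 a0E] := divsub_div HM DP (ltn0Sn N) (divsubN DP Da).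
have -> : (b1 - s 1%N) *+ N.+1 + a = (b1 - s 1%N - a0) *+ N.+1.
  by rewrite [in RHS]mulrnBl a0E opprK.
have [g ag g0] := distP _ Da0; have [n [a' [Da' a'g ga']]] := old _ _ Da0 ag.
have yg : exists2 y, P y & y <= g.
  case: n a'g ga' => [|n] a'g ga'; first by move: ga'; rewrite mulr0n => h; exfalso; dlra HM.
  have a'P : P a' by split=> //; exists a0, g, n.+1.
  have [y Py yE] := Pdiv a' n a'P; exists y => //.
  by apply/(doag_lerMn HM _ _ (ltn0Sn n)); rewrite yE.
have scale (x z : M) : infsmall z x -> infsmall z (x *+ N.+1).
  move=> zx k; have [h1 h2] := zx k; have x0 := infsmall_gt0 zx.
  have := doag_mulrn_ge0 HM N (ltW x0); rewrite mulrS.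
  by split; dlra HM.
case: ag => -[ab gE].
  constructor 2 => k; apply: scale; have := large k g g0 yg.
  by rewrite gE; congr infsmall; dlra HM.
constructor 3 => k; rewrite -mulNrn; apply: scale => l; have [h1 h2] := large k g g0 yg l.
have [s10 _] := sP 1%N.
by split; dlra HM.
Qed.

End Forking.

(** * Reduction to an interval around a term over C *)

Lemma teval_setU (M : porderZmodType) (A C : set M) (t : term (A `|` C)) :
  exists (r : term C) (s : term A), teval set_val t = teval set_val r + teval set_val s.
Proof.
elim: t => [v||t [r [s h]] t' [r' [s' h']]|t [r [s h]]].
- case: (set_val_in v) => h; have [w wE] := set_val_surj h.
    by exists (TZero C), (TVar w); rewrite /= wE add0r.
  by exists (TVar w), (TZero A); rewrite /= wE addr0.
- by exists (TZero C), (TZero A); rewrite /= addr0.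
- by exists (TAdd r r'), (TAdd s s'); rewrite /= h h' addrACA.
- by exists (TOpp r), (TOpp s); rewrite /= h opprD.
Qed.

Theorem mainTheorem1 (M : porderZmodType) (A B C : set M) :
  is_DOAG M ->
  succ_saturated (A `|` B `|` C) ->
  strongly_succ_homogeneous (A `|` B `|` C) ->
  (forking_independent C B A <->
   (forall b1 b2 : M,
      dcl_gen (A `|` B) b1 -> dcl_gen (A `|` B) b2 -> b1 <= b2 ->
      (`[b1, b2] `&` dcl_gen (A `|` C) !=set0) ->
      (`[b1, b2] `&` dcl_gen A !=set0))).
Proof.
move=> HM Msat _; split=> [fi b1 b2 Bb1 Bb2 b12 [c [/= cb Cc]]|cuts]; last first.
  apply: (cuts_nonforking HM) => d1 d2 c Bd1 Bd2 Cc d1c cd2.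
  have [||a [/= ad Aa]] := cuts d1 d2 Bd1 Bd2; first exact: le_trans cd2.
    by exists c; split=> //=; rewrite in_itv /= d1c.
  by exists a => //; move: ad; rewrite in_itv /= => /andP[].
apply: contrapT => noA; apply: fi; have [b1c cb2] : b1 <= c /\ c <= b2.
  by move: cb; rewrite in_itv /= => /andP[].
(* Scaling by [n] and subtracting the contribution [al] of A gives an interval around the value of a
   term over C alone. *)
rewrite dcl_genE in Cc; have [n [t [n0 ct]]] := Cc; have [r [s tE]] := teval_setU t.
set al := teval set_val s in tE.
have Dal : dcl_gen A al by rewrite dcl_genE; exact: dspan_teval.
have ABal : dcl_gen (A `|` B) al by apply: dcl_gen_sub Dal => x; left.
have DP := dcl_gen_divsub A; have DBP := dcl_gen_divsub (A `|` B).
have Be1 : dcl_gen (A `|` B) (b1 *+ n - al) by apply: divsubB => //; exact: divsubMn.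
have Be2 : dcl_gen (A `|` B) (b2 *+ n - al) by apply: divsubB => //; exact: divsubMn.
have noD a : dcl_gen A a -> b1 *+ n - al <= a -> a <= b2 *+ n - al -> False.
  move=> Da h1 h2; have [z Dz zE] := divsub_div HM DP n0 (divsubD DP Da Dal).
  apply: noA; exists z; split=> //=; rewrite in_itv /=; apply/andP.
  by split; apply/(doag_lerMn HM _ _ n0); rewrite zE; dlra HM.
move/(doag_lerMn HM _ _ n0): b1c; move/(doag_lerMn HM _ _ n0): cb2; rewrite ct tE => cb2 b1c.
set e1 := b1 *+ n - al in Be1 noD; set e2 := b2 *+ n - al in Be2 noD.
have e1r : e1 <= teval set_val r by rewrite /e1; dlra HM.
have re2 : teval set_val r <= e2 by rewrite /e2; dlra HM.
have e12 := le_trans e1r re2.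
have [[a [Da ae1 new]]|nonew1] := pselect (exists a, [/\ dcl_gen A a, a < e1 & new_class A (e1 - a)]).
  exact: (forks_of_new_class HM Msat Be1 Be2 e12 noD e1r re2 Da ae1 new).
(* A new class on the right becomes one on the left for the opposite interval [-e2, -e1] and the
   term [TOpp r]. *)
have [[a [Da ae2 new]]|nonew2] := pselect (exists a, [/\ dcl_gen A a, e2 < a & new_class A (a - e2)]).
  have Ne1 : dcl_gen (A `|` B) (- e1) by exact: divsubN.
  have Ne2 : dcl_gen (A `|` B) (- e2) by exact: divsubN.
  have Ne12 : - e2 <= - e1 by dlra HM.
  apply: (@forks_of_new_class _ _ _ _ HM Msat _ _ Ne2 Ne1 Ne12 _ (TOpp r) (- a)) => /=.
  - by move=> x Dx h1 h2; apply: (noD (- x) (divsubN DP Dx)); dlra HM.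
  - by dlra HM.
  - by dlra HM.
  - exact: divsubN.
  - by dlra HM.
  - by rewrite (_ : - e2 - - a = a - e2) //; dlra HM.
apply: (forks_of_old_classes HM Msat Be1 Be2 e12 noD e1r re2) => a g Da ag.
apply: contrapT => nold.
have new : new_class A g by move=> k x Dx h1 h2; apply: nold; exists k, x.
case: ag => -[lt gE]; rewrite gE in new.
  by apply: nonew1; exists a.
by apply: nonew2; exists a.
Qed.
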